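(* The decision problem $\mathsf{PAST}$ (given a $\mathsf{pGCL}$ program $P$, decide whether $P\in\mathsf{PAST}$) is $\Pi^1_1$-complete.
   Context: pGCL. Fix a countable set $\mathrm{Var}$ of variables taking rational values. Programs are generated by the grammar $P ::= \bot \mid v:=e \mid P;P \mid P\oplus_p P \mid P\,[\!]\,P \mid \mathtt{while}(b)\{P\}$, where $v\in\mathrm{Var}$, $e,p$ are arithmetical expressions and $b$ is a boolean expression over $\mathrm{Var}$, and $\bot$ is the empty program ($\oplus_p$ is probabilistic choice, $[\!]$ is binary nondeterministic choice). A valuation is $\eta:\mathrm{Var}\to\mathbb{Q}$, and $[\![e]\!]_\eta$ is the value of $e$ under $\eta$. A scheduler is a total function $f:\{L_n,R_n,L_p,R_p\}^*\to\{L_n,R_n\}$; $\mathbb{F}$ is the set of schedulers. An execution state is a tuple $(P,\eta,a,w)$ with $P$ a program, $\eta$ a valuation, $a\in\mathbb{Q}\cap(0,1]$ and $w\in\{L_n,R_n,L_p,R_p\}^*$; a program state is a pair $(P,\eta)$; states whose program is $\bot$ are terminal. For $f\in\mathbb{F}$, $\to_f$ is the smallest relation on execution states such that: $(v:=e,\eta,a,w)\to_f(\bot,\eta[v\mapsto[\![e]\!]_\eta],a,w)$; if $(P_1,\eta,a,w)\to_f(P_1',\eta',a',w')$ then $(P_1;P_2,\eta,a,w)\to_f(P_1';P_2,\eta',a',w')$; $(\bot;P_2,\eta,a,w)\to_f(P_2,\eta,a,w)$; $(P_1\oplus_pP_2,\eta,a,w)\to_f(P_2,\eta,a,wR_p)$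 if $[\![p]\!]_\eta\le 0$, $\to_f(P_1,\eta,a,wL_p)$ if $[\![p]\!]_\eta\ge1$, and if $0<[\![p]\!]_\eta<1$ both $\to_f(P_1,\eta,a\cdot[\![p]\!]_\eta,wL_p)$ and $\to_f(P_2,\eta,a\cdot(1-[\![p]\!]_\eta),wR_p)$; $(P_1[\!]P_2,\eta,a,w)\to_f(P_1,\eta,a,wL_n)$ if $f(w)=L_n$ and $\to_f(P_2,\eta,a,wR_n)$ if $f(w)=R_n$; $(\mathtt{while}(b)\{P\},\eta,a,w)\to_f(P;\mathtt{while}(b)\{P\},\eta,a,w)$ if $[\![b]\!]_\eta$ is true and $\to_f(\bot,\eta,a,w)$ otherwise. $\to_f^n$ ($n\ge1$) is the $n$-fold composition of $\to_f$. For a program state $\sigma=(P,\eta)$ put $\sigma_e=(P,\eta,1,\varepsilon)$. The initial state of a program $P$ is $\sigma_P=(P,\eta_0)$ where $\eta_0$ maps every variable to $0$. $\mathrm{Prob}((P,\eta,a,w))=a$. For $k\in\mathbb{N}$, $T_{\le k}(\sigma,f)$ is the set of terminal execution states $\tau$ with $\sigma_e\to_f^n\tau$ for some $n\le k$, and $\mathrm{ExpRuntime}(\sigma,f)=\sum_{k\in\mathbb{N}}\big(1-\sum_{\tau\in T_{\le k}(\sigma,f)}\mathrm{Prob}(\tau)\big)\in[0,\infty]$. $\mathsf{PAST}$ is the set of programs $P$ such that for every scheduler $f\in\mathbb{F}$ there is $n\in\mathbb{N}$ with $\mathrm{ExpRuntime}(\sigma_P,f)<n$. Programs are identified with natural numbers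 via a fixed effective encoding; $\Pi^1_1$ is the lightface co-analytic class, and completeness is with respect to recursive many-one reductions. *)

(* Defs.v *)
From HB Require Import structures.
From mathcomp Require Import all_boot all_order all_algebra.
From mathcomp Require Import boolp classical_sets reals constructive_ereal ereal esum.
From mathcomp Require Import Rstruct.
From Stdlib Require Rdefinitions List.
Notation R := Rdefinitions.R.

Set Implicit Arguments.
Unset Strict Implicit.
Unset Printing Implicit Defensive.
Import Order.TTheory GRing.Theory Num.Theory.

Definition var := nat.

Inductive aexp : Type :=
| AConst of rat
| AVar of var
| AAdd of aexp & aexp
| ASub of aexp & aexp
| AMul of aexp & aexp.

Inductive bexp : Type :=
| BTrue
| BFalse
| BLe of aexp & aexp
| BLt of aexp & aexp
| BEq of aexp & aexp
| BNot of bexp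
| BAnd of bexp & bexp
| BOr of bexp & bexp.

Inductive prog : Type :=
| PBot
| PAssign of var & aexp
| PSeq of prog & prog
| PProb of prog & aexp & prog
| PNondet of prog & prog
| PWhile of bexp & prog.

Definition valuation := var -> rat.

Local Open Scope ring_scope.

Fixpoint aeval (eta : valuation) (e : aexp) : rat :=
  match e with
  | AConst q => q
  | AVar v => eta v
  | AAdd e1 e2 => aeval eta e1 + aeval eta e2
  | ASub e1 e2 => aeval eta e1 - aeval eta e2
  | AMul e1 e2 => aeval eta e1 * aeval eta e2
  end.

Fixpoint beval (eta : valuation) (b : bexp) : bool :=
  match b with
  | BTrue => true
  | BFalse => false
  | BLe e1 e2 => aeval eta e1 <= aeval eta e2
  | BLt e1 e2 => aeval eta e1 < aeval eta e2
  | BEq e1 e2 => aeval eta e1 == aeval eta e2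
  | BNot b => ~~ beval eta b
  | BAnd b1 b2 => beval eta b1 && beval eta b2
  | BOr b1 b2 => beval eta b1 || beval eta b2
  end.

Definition upd (eta : valuation) (v : var) (q : rat) : valuation :=
  fun x => if x == v then q else eta x.

Inductive letter : Type := Ln | Rn | Lp | Rp.

(* A scheduler is a total function {L_n,R_n,L_p,R_p}^* -> {L_n,R_n};
   the codomain {L_n,R_n} is encoded by bool (true = L_n, false = R_n). *)
Definition scheduler := list letter -> bool.

Record estate : Type := EState {
  es_prog : prog;
  es_val  : valuation;
  es_prob : rat;
  es_word : list letter }.

Definition terminal (s : estate) : Prop := es_prog s = PBot.

Inductive step (f : scheduler) : estate -> estate -> Prop :=
| st_assign v e eta a w :
    step f (EState (PAssign v e) eta a w) (EState PBot (upd eta v (aeval eta e)) a w)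
| st_seq P1 P1' P2 eta eta' a a' w w' :
    step f (EState P1 eta a w) (EState P1' eta' a' w') ->
    step f (EState (PSeq P1 P2) eta a w) (EState (PSeq P1' P2) eta' a' w')
| st_seq_bot P2 eta a w :
    step f (EState (PSeq PBot P2) eta a w) (EState P2 eta a w)
| st_prob_le0 P1 p P2 eta a w :
    aeval eta p <= 0 ->
    step f (EState (PProb P1 p P2) eta a w) (EState P2 eta a (w ++ [:: Rp]))
| st_prob_ge1 P1 p P2 eta a w :
    1 <= aeval eta p ->
    step f (EState (PProb P1 p P2) eta a w) (EState P1 eta a (w ++ [:: Lp]))
| st_prob_L P1 p P2 eta a w :
    0 < aeval eta p < 1 ->
    step f (EState (PProb P1 p P2) eta a w)
           (EState P1 eta (a * aeval eta p) (w ++ [:: Lp]))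
| st_prob_R P1 p P2 eta a w :
    0 < aeval eta p < 1 ->
    step f (EState (PProb P1 p P2) eta a w)
           (EState P2 eta (a * (1 - aeval eta p)) (w ++ [:: Rp]))
| st_nondet_L P1 P2 eta a w :
    f w = true ->
    step f (EState (PNondet P1 P2) eta a w) (EState P1 eta a (w ++ [:: Ln]))
| st_nondet_R P1 P2 eta a w :
    f w = false ->
    step f (EState (PNondet P1 P2) eta a w) (EState P2 eta a (w ++ [:: Rn]))
| st_while_true b P eta a w :
    beval eta b = true ->
    step f (EState (PWhile b P) eta a w) (EState (PSeq P (PWhile b P)) eta a w)
| st_while_false b P eta a w :
    beval eta b = false ->
    step f (EState (PWhile b P) eta a w) (EState PBot eta a w).

Fixpoint stepn (f : scheduler) (n : nat) (s t : estate) : Prop :=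
  match n with
  | 0 => step f s t
  | n.+1 => exists u, step f s u /\ stepn f n u t
  end.

Definition pstate := (prog * valuation)%type.
Definition init_estate (sigma : pstate) : estate := EState sigma.1 sigma.2 1 [::].

Definition eta0 : valuation := fun _ => 0.
Definition init_pstate (P : prog) : pstate := (P, eta0).

Definition Prob (s : estate) : R := ratr (es_prob s).

Definition T_le (k : nat) (sigma : pstate) (f : scheduler) : set {classic estate} :=
  [set t : {classic estate} | terminal t /\
     exists n : nat, (0 < n)%N /\ (n <= k)%N /\ stepn f n.-1 (init_estate sigma) t].

Local Open Scope ereal_scope.

Definition ExpRuntime (sigma : pstate) (f : scheduler) : \bar R :=
  \esum_(k in [set: nat])
     (1 - \esum_(t in T_le k sigma f) (Prob t)%:E).

Definition PAST (P : prog) : Prop :=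
  forall f : scheduler, exists n : nat, ExpRuntime (init_pstate P) f < (n%:R)%:E.

Local Close Scope ereal_scope.

Definition cpair (x y : nat) : nat := (((x + y) * (x + y).+1) %/ 2 + y)%N.

Definition enc_int (z : int) : nat :=
  match z with Posz n => (n.*2)%N | Negz n => (n.*2.+1)%N end.

Definition enc_rat (q : rat) : nat := cpair (enc_int (numq q)) (enc_int (denq q)).

Fixpoint enc_aexp (e : aexp) : nat :=
  match e with
  | AConst q => cpair 0 (enc_rat q)
  | AVar v => cpair 1 v
  | AAdd e1 e2 => cpair 2 (cpair (enc_aexp e1) (enc_aexp e2))
  | ASub e1 e2 => cpair 3 (cpair (enc_aexp e1) (enc_aexp e2))
  | AMul e1 e2 => cpair 4 (cpair (enc_aexp e1) (enc_aexp e2))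
  end.

Fixpoint enc_bexp (b : bexp) : nat :=
  match b with
  | BTrue => cpair 0 0
  | BFalse => cpair 1 0
  | BLe e1 e2 => cpair 2 (cpair (enc_aexp e1) (enc_aexp e2))
  | BLt e1 e2 => cpair 3 (cpair (enc_aexp e1) (enc_aexp e2))
  | BEq e1 e2 => cpair 4 (cpair (enc_aexp e1) (enc_aexp e2))
  | BNot b => cpair 5 (enc_bexp b)
  | BAnd b1 b2 => cpair 6 (cpair (enc_bexp b1) (enc_bexp b2))
  | BOr b1 b2 => cpair 7 (cpair (enc_bexp b1) (enc_bexp b2))
  end.

Fixpoint enc_prog (P : prog) : nat :=
  match P with
  | PBot => cpair 0 0
  | PAssign v e => cpair 1 (cpair v (enc_aexp e))
  | PSeq P1 P2 => cpair 2 (cpair (enc_prog P1) (enc_prog P2))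
  | PProb P1 p P2 => cpair 3 (cpair (enc_prog P1) (cpair (enc_aexp p) (enc_prog P2)))
  | PNondet P1 P2 => cpair 4 (cpair (enc_prog P1) (enc_prog P2))
  | PWhile b P => cpair 5 (cpair (enc_bexp b) (enc_prog P))
  end.

Definition PAST_set (n : nat) : Prop := exists P : prog, enc_prog P = n /\ PAST P.

Inductive recf : Type :=
| RZero
| RSucc
| RProj of nat
| RComp of recf & list recf
| RPrec of recf & recf
| RMin of recf.

Inductive reval : recf -> seq nat -> nat -> Prop :=
| ev_zero l : reval RZero l 0
| ev_succ x l : reval RSucc (x :: l) x.+1
| ev_proj i l : reval (RProj i) l (nth 0 l i)
| ev_comp f gs l ms v :
    List.Forall2 (fun g m => reval g l m) gs ms -> reval f ms v ->
    reval (RComp f gs) l v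
| ev_prec0 f g l v : reval f l v -> reval (RPrec f g) (0 :: l) v
| ev_precS f g x l r v :
    reval (RPrec f g) (x :: l) r -> reval g (x :: r :: l) v ->
    reval (RPrec f g) (x.+1 :: l) v
| ev_min f l v :
    reval f (v :: l) 0 ->
    (forall m, (m < v)%N -> exists k, reval f (m :: l) k.+1) ->
    reval (RMin f) l v.

Definition recursive_fun (g : nat -> nat) : Prop :=
  exists c : recf, forall n, reval c [:: n] (g n).

Definition recursive_rel (Rl : nat -> nat -> bool) : Prop :=
  exists c : recf, forall n s, reval c [:: n; s] (nat_of_bool (Rl n s)).

Fixpoint seq_code (s : seq nat) : nat :=
  match s with [::] => 0%N | x :: s' => (cpair x (seq_code s')).+1 end.

Definition prefix_code (alpha : nat -> nat) (m : nat) : nat :=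
  seq_code (mkseq alpha m).

(* Lightface Pi^1_1 (Kleene normal form):
   A = { n | forall alpha : N -> N, exists m, R(n, \bar{alpha}(m)) } with R recursive. *)
Definition Pi11 (A : nat -> Prop) : Prop :=
  exists Rl : nat -> nat -> bool, recursive_rel Rl /\
    forall n, A n <-> forall alpha : nat -> nat, exists m, Rl n (prefix_code alpha m).

Definition many_one_reducible (B A : nat -> Prop) : Prop :=
  exists g : nat -> nat, recursive_fun g /\ forall n, B n <-> A (g n).

Definition Pi11_complete (A : nat -> Prop) : Prop :=
  Pi11 A /\ forall B : nat -> Prop, Pi11 B -> many_one_reducible B A.

(* Main.v *)
(* A scheduler and a word of random outcomes determine the run, so the mass
   [alive f k s] still running after [k] steps is a rational that can be
   computed from finitely many values of the scheduler [f].  Positive almost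
   sure termination says that for every [f] some [B] bounds all partial sums
   [runtime f N]; Skolemizing the inner quantifiers, this is
     forall f g, exists B, runtime f (g B) <= B,
   and coding [f] and [g] in the even and odd entries of one sequence gives a
   lightface Pi^1_1 definition.

   Conversely, for a recursive predicate [test] on finite sequences consider the
   program that lets the scheduler extend a sequence entry by entry until [test]
   holds.  Before each binary decision of the scheduler the program stops with
   probability 1/2, and after completing an entry it waits for a number of steps
   inverse to the surviving probability.  Every completed entry costs expected
   time at least 1, while the coin flips make it useless for the scheduler to
   postpone the end of an entry, so the expected time is infinite under some
   scheduler if and only if [test] fails on all prefixes of some sequence. *)
Require Import Defs.
From mathcomp Require Import all_boot all_order all_algebra.
From mathcomp Require Import zify lra ring.
From mathcomp Require Import boolp classical_sets cardinality fsbigop.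
From mathcomp Require Import reals constructive_ereal ereal esum.
From mathcomp Require Import topology normedtype sequences.
From mathcomp Require Import Rstruct.

Set Implicit Arguments.
Unset Strict Implicit.
Unset Printing Implicit Defensive.
Import Order.TTheory GRing.Theory Num.Theory.

(** * Recursive functions *)

(** Once a scheduler is fixed, the hardness program has a single surviving path: a coin flip either
    drops out, leaving a remainder of bounded length, or continues along the path. Expected time is
    therefore additive along this path, up to the cost of the dropped branches, and it suffices to
    bound each segment from below and from above. After k survived flips the mass is 2^-k. A round
    of bounded length costs O(2^-k), so endless rounds sum to a geometric series, while waiting 2^k
    steps costs at least 1. Evaluating the test takes finite time without any a priori bound; this
    is harmless, because only finitely many evaluations occur when the test holds on some prefix. An
    entry can take infinitely many values, so no compactness argument applies. Instead, with the
    scheduler fixed, unbounded time is passed from one prefix to some one-entry extension, and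
    dependent choice assembles a sequence on which the test never holds. *)

Definition tri (n : nat) : nat := (n * n.+1) %/ 2.

Lemma triS n : tri n.+1 = tri n + n.+1.
Proof.
have e : n.+1 * n.+2 = n.+1 * 2 + n * n.+1 by lia.
by rewrite /tri e divnMDl // addnC.
Qed.

Lemma leq_tri m n : m <= n -> tri m <= tri n.
Proof.
move=> le_mn; rewrite -(subnKC le_mn); elim: (n - m) => [|k IHk].
  by rewrite addn0.
by rewrite addnS triS; apply: leq_trans IHk (leq_addr _ _).
Qed.

Lemma cpairE x y : cpair x y = tri (x + y) + y.
Proof. by []. Qed.

Lemma tri_ge n : n <= tri n.
Proof. by elim: n => // n IHn; rewrite triS; lia. Qed.

(** Triangular numbers cut the naturals into disjoint intervals, one per diagonal, so a code
    determines [x + y]. Injectivity and the computation of the inverse both start here. *)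
Lemma cpair_diag x y s : tri s <= cpair x y < tri s.+1 -> s = x + y.
Proof.
rewrite cpairE => /andP[h1 h2].
have h3 : tri (x + y) + y < tri (x + y).+1 by rewrite triS; lia.
case: (ltngtP s (x + y)) => // h.
  by have := leq_tri h; lia.
by have := leq_tri h; lia.
Qed.

Lemma cpair_in_diag x y : tri (x + y) <= cpair x y < tri (x + y).+1.
Proof. by rewrite cpairE triS; lia. Qed.

Lemma cpair_inj x y x' y' : cpair x y = cpair x' y' -> x = x' /\ y = y'.
Proof.
move=> e; have := cpair_in_diag x y; rewrite e => /cpair_diag s.
by move: e; rewrite !cpairE s => /addnI e; split=> //; lia.
Qed.

(** Successor in the diagonal enumeration: along a diagonal, then to the start of the next one.
    Iterating it gives an inverse of [cpair] by plain induction. *)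
Definition cnext (p : nat * nat) : nat * nat :=
  if p.1 is x.+1 then (x, p.2.+1) else (p.2.+1, 0).

Definition cunpair (z : nat) : nat * nat := iter z cnext (0, 0).
Definition cfst z := (cunpair z).1.
Definition csnd z := (cunpair z).2.

Lemma cpair_unpair z : cpair (cfst z) (csnd z) = z.
Proof.
rewrite /cfst /csnd; elim: z => [//|z]; rewrite [cunpair z.+1]/= /cnext.
case: (cunpair z) => -[|x] y /= <-; rewrite !cpairE.
  by rewrite !addn0 triS add0n addnS.
by rewrite addnS -addSn addnS.
Qed.

Lemma cfstK x y : cfst (cpair x y) = x.
Proof. by have /cpair_inj[] := cpair_unpair (cpair x y). Qed.

Lemma csndK x y : csnd (cpair x y) = y.
Proof. by have /cpair_inj[] := cpair_unpair (cpair x y). Qed.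

Lemma cpair_ge x y : x + y <= cpair x y.
Proof. by rewrite cpairE; have := tri_ge (x + y); lia. Qed.

Lemma cpair_gt x y : 0 < x -> y < cpair x y.
Proof. by have := cpair_ge x y; lia. Qed.

(* Functions of an argument list; missing arguments read as 0. *)
Definition lcomputable (F : seq nat -> nat) : Prop :=
  exists c, forall l, reval c l (F l).

Lemma lcomp_ext F G : F =1 G -> lcomputable F -> lcomputable G.
Proof. by move=> e [c hc]; exists c => l; rewrite -e. Qed.

Lemma lcomp_nth i : lcomputable (fun l => nth 0 l i).
Proof. by exists (RProj i) => l; apply: ev_proj. Qed.

Lemma lcomp_comp1 F A : lcomputable F -> lcomputable A ->
  lcomputable (fun l => F [:: A l]).
Proof.
move=> [f hf] [a ha]; exists (RComp f [:: a]) => l.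
by apply: (ev_comp (ms := [:: A l])) => //; do !constructor.
Qed.

Lemma lcomp_comp2 F A B : lcomputable F -> lcomputable A -> lcomputable B ->
  lcomputable (fun l => F [:: A l; B l]).
Proof.
move=> [f hf] [a ha] [b hb]; exists (RComp f [:: a; b]) => l.
by apply: (ev_comp (ms := [:: A l; B l])) => //; do !constructor.
Qed.

Lemma lcomp_iteri F G : lcomputable F -> lcomputable G ->
  lcomputable (fun l => iteri (nth 0 l 0)
    (fun i r => G [:: i; r; nth 0 l 1]) (F [:: nth 0 l 1])).
Proof.
move=> [f hf] [g hg]; exists (RComp (RPrec f g) [:: RProj 0; RProj 1]) => l.
apply: (ev_comp (ms := [:: nth 0 l 0; nth 0 l 1])).
  by do !constructor.
elim: (nth 0 l 0) => [|n IHn] /=; first by constructor.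
by apply: ev_precS; [exact: IHn|exact: hg].
Qed.

Lemma lcomp_min F V : lcomputable F ->
  (forall y, F [:: V y; y] = 0) -> (forall x y, x < V y -> F [:: x; y] <> 0) ->
  lcomputable (fun l => V (nth 0 l 0)).
Proof.
move=> [f hf] h0 hm; exists (RComp (RMin f) [:: RProj 0]) => l.
apply: (ev_comp (ms := [:: nth 0 l 0])); first by do !constructor.
apply: ev_min => [|m lt_m]; first by rewrite -[X in reval _ _ X](h0 (nth 0 l 0)).
exists (F [:: m; nth 0 l 0]).-1.
by rewrite prednK ?lt0n //; apply/eqP/hm.
Qed.

Lemma lcomp_0 : lcomputable (fun=> 0).
Proof. by exists RZero => l; constructor. Qed.

Lemma lcomp_S A : lcomputable A -> lcomputable (fun l => (A l).+1).
Proof.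
move=> [a ha]; exists (RComp RSucc [:: a]) => l.
by apply: (ev_comp (ms := [:: A l])); do !constructor.
Qed.

Lemma lcomp_app2 (f : nat -> nat -> nat) A B :
  lcomputable (fun l => f (nth 0 l 0) (nth 0 l 1)) ->
  lcomputable A -> lcomputable B -> lcomputable (fun l => f (A l) (B l)).
Proof. exact: lcomp_comp2. Qed.

Lemma lcomp_app1 (f : nat -> nat) A :
  lcomputable (fun l => f (nth 0 l 0)) ->
  lcomputable A -> lcomputable (fun l => f (A l)).
Proof. exact: lcomp_comp1. Qed.

Lemma lcomp_add A B :
  lcomputable A -> lcomputable B -> lcomputable (fun l => A l + B l).
Proof.
apply: lcomp_app2.
apply: lcomp_ext (lcomp_iteri (lcomp_nth 0) (lcomp_S (lcomp_nth 1))) => l /=.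
by elim: (nth 0 l 0) => //= n ->.
Qed.

Lemma lcomp_mul A B :
  lcomputable A -> lcomputable B -> lcomputable (fun l => A l * B l).
Proof.
apply: lcomp_app2.
apply: lcomp_ext (lcomp_iteri lcomp_0 (lcomp_add (lcomp_nth 1) (lcomp_nth 2))) => l /=.
by elim: (nth 0 l 0) => //= n ->; rewrite mulSn addnC.
Qed.

Lemma lcomp_pred A : lcomputable A -> lcomputable (fun l => (A l).-1).
Proof.
apply: lcomp_app1.
apply: lcomp_ext (lcomp_iteri lcomp_0 (lcomp_nth 0)) => l /=.
by case: (nth 0 l 0).
Qed.

Lemma lcomp_sub A B :
  lcomputable A -> lcomputable B -> lcomputable (fun l => A l - B l).
Proof.
move=> hA hB; apply: (lcomp_app2 (f := fun b a => a - b)) hB hA.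
apply: lcomp_ext (lcomp_iteri (lcomp_nth 0) (lcomp_pred (lcomp_nth 1))) => l /=.
by elim: (nth 0 l 0) => [|n IHn] /=; rewrite ?subn0 // IHn subnS.
Qed.

Lemma lcomp_tri A : lcomputable A -> lcomputable (fun l => tri (A l)).
Proof.
apply: lcomp_app1.
apply: lcomp_ext (lcomp_iteri lcomp_0
  (lcomp_add (lcomp_nth 1) (lcomp_S (lcomp_nth 0)))) => l /=.
by elim: (nth 0 l 0) => //= n ->; rewrite triS.
Qed.

Lemma lcomp_cpair A B :
  lcomputable A -> lcomputable B -> lcomputable (fun l => cpair (A l) (B l)).
Proof.
move=> hA hB; have := lcomp_add (lcomp_tri (lcomp_add hA hB)) hB.
exact: lcomp_ext.
Qed.

(** The diagonal of [z] is the least [s] with [z < tri s.+1], and the truncated difference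
    [z.+1 - tri s.+1] vanishes exactly under that condition, so minimization finds it. Both
    projections follow by subtraction. *)
Lemma lcomp_cdiag A :
  lcomputable A -> lcomputable (fun l => cfst (A l) + csnd (A l)).
Proof.
apply: (lcomp_app1 (f := fun z => cfst z + csnd z)).
apply: (lcomp_min (V := fun z => cfst z + csnd z)
  (F := fun l => (nth 0 l 1).+1 - tri (nth 0 l 0).+1)).
- by apply: lcomp_sub; [|apply: lcomp_tri]; apply: lcomp_S; apply: lcomp_nth.
- move=> z /=; have := cpair_in_diag (cfst z) (csnd z).
  by rewrite cpair_unpair; lia.
- move=> x z /= /leq_tri; have := cpair_in_diag (cfst z) (csnd z).
  by rewrite cpair_unpair; lia.
Qed.

Lemma lcomp_csnd A : lcomputable A -> lcomputable (fun l => csnd (A l)).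
Proof.
move=> hA; have := lcomp_sub hA (lcomp_tri (lcomp_cdiag hA)).
by apply: lcomp_ext => l; rewrite -{1}(cpair_unpair (A l)) cpairE addKn.
Qed.

Lemma lcomp_cfst A : lcomputable A -> lcomputable (fun l => cfst (A l)).
Proof.
move=> hA; have := lcomp_sub (lcomp_cdiag hA) (lcomp_csnd hA).
by apply: lcomp_ext => l; rewrite addnK.
Qed.

(* Several arguments are passed as one nested pair, which is how binders of
   the recursors below are kept in a single context variable. *)
Definition computable (F : nat -> nat) : Prop :=
  lcomputable (fun l => F (nth 0 l 0)).

Definition computableb (B : nat -> bool) : Prop :=
  computable (fun x => nat_of_bool (B x)).

Lemma comp_ext F G : F =1 G -> computable F -> computable G.
Proof. by move=> e; apply: lcomp_ext => l; apply: e. Qed.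

Lemma comp_id : computable (fun x => x).
Proof. exact: lcomp_nth. Qed.

Lemma comp_S F : computable F -> computable (fun x => (F x).+1).
Proof. exact: lcomp_S. Qed.

Lemma comp_const n : computable (fun=> n).
Proof. by elim: n => [|n]; [exact: lcomp_0|exact: comp_S]. Qed.

Lemma comp_comp F A : computable F -> computable A -> computable (fun x => F (A x)).
Proof. exact: lcomp_app1. Qed.

Lemma comp_add A B : computable A -> computable B -> computable (fun x => A x + B x).
Proof. exact: lcomp_add. Qed.

Lemma comp_mul A B : computable A -> computable B -> computable (fun x => A x * B x).
Proof. exact: lcomp_mul. Qed.

Lemma comp_sub A B : computable A -> computable B -> computable (fun x => A x - B x).
Proof. exact: lcomp_sub. Qed.

Lemma comp_pred A : computable A -> computable (fun x => (A x).-1).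
Proof. exact: lcomp_pred. Qed.

Lemma comp_cpair A B :
  computable A -> computable B -> computable (fun x => cpair (A x) (B x)).
Proof. exact: lcomp_cpair. Qed.

Lemma comp_cfst A : computable A -> computable (fun x => cfst (A x)).
Proof. exact: lcomp_cfst. Qed.

Lemma comp_csnd A : computable A -> computable (fun x => csnd (A x)).
Proof. exact: lcomp_csnd. Qed.

Lemma comp_app2 (f : nat -> nat -> nat) A B :
  computable (fun z => f (cfst z) (csnd z)) -> computable A -> computable B ->
  computable (fun x => f (A x) (B x)).
Proof.
move=> hf hA hB; apply: comp_ext (comp_comp hf (comp_cpair hA hB)) => x.
by rewrite cfstK csndK.
Qed.

Lemma comp_app3 (f : nat -> nat -> nat -> nat) A B C :
  computable (fun z => f (cfst z) (cfst (csnd z)) (csnd (csnd z))) ->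
  computable A -> computable B -> computable C ->
  computable (fun x => f (A x) (B x) (C x)).
Proof.
move=> hf hA hB hC.
apply: comp_ext (comp_comp hf (comp_cpair hA (comp_cpair hB hC))) => x.
by rewrite !(cfstK, csndK).
Qed.

Lemma comp_iteri X G A :
  computable X ->
  computable (fun z => G (cfst z) (cfst (csnd z)) (csnd (csnd z))) ->
  computable A ->
  computable (fun x => iteri (X x) (fun i r => G i r x) (A x)).
Proof.
move=> hX hG hA.
pose G' l := G (nth 0 l 0) (nth 0 l 1) (nth 0 l 2).
have hG' : lcomputable G'.
  have := lcomp_app1 (f := fun z => G (cfst z) (cfst (csnd z)) (csnd (csnd z))) hG
    (lcomp_cpair (lcomp_nth 0)
    (lcomp_cpair (lcomp_nth 1) (lcomp_nth 2))).
  by apply: lcomp_ext => l; rewrite !(cfstK, csndK).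
exact: (lcomp_app2 (f := fun n x => iteri n (fun i r => G i r x) (A x))
  (lcomp_iteri hA hG') hX comp_id).
Qed.

Lemma comp_iter X G A :
  computable X ->
  computable (fun z => G (cfst z) (csnd z)) ->
  computable A ->
  computable (fun x => iter (X x) (fun r => G r x) (A x)).
Proof.
move=> hX hG hA.
have hG' : computable (fun z => G (cfst (csnd z)) (csnd (csnd z))).
  exact: (comp_comp hG (comp_csnd comp_id)).
apply: comp_ext (comp_iteri (G := fun _ r x => G r x) hX hG' hA) => x.
by elim: (X x) => //= n ->.
Qed.

Lemma compb_ext F G : F =1 G -> computableb F -> computableb G.
Proof. by move=> e; apply: comp_ext => x; rewrite e. Qed.

Lemma comp_bool B : computableb B -> computable (fun x => nat_of_bool (B x)).
Proof. by []. Qed.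

Lemma compb_leq A B : computable A -> computable B -> computableb (fun x => A x <= B x).
Proof.
move=> hA hB; apply: comp_ext (comp_sub (comp_const 1) (comp_sub hA hB)) => x.
by rewrite /leq; case: (A x - B x).
Qed.

Lemma compb_neg B : computableb B -> computableb (fun x => ~~ B x).
Proof.
by move=> hB; apply: comp_ext (comp_sub (comp_const 1) (comp_bool hB)) => x /=; case: (B x).
Qed.

Lemma compb_and A B : computableb A -> computableb B -> computableb (fun x => A x && B x).
Proof.
move=> hA hB; apply: comp_ext (comp_mul (comp_bool hA) (comp_bool hB)) => x /=.
by case: (A x); case: (B x).
Qed.

Lemma compb_or A B : computableb A -> computableb B -> computableb (fun x => A x || B x).
Proof.
move=> hA hB; apply: compb_ext (compb_neg (compb_and (compb_neg hA) (compb_neg hB))) => x.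
by rewrite negb_and !negbK.
Qed.

Lemma compb_eq A B : computable A -> computable B -> computableb (fun x => A x == B x).
Proof.
move=> hA hB; apply: compb_ext (compb_and (compb_leq hA hB) (compb_leq hB hA)) => x.
by rewrite -eqn_leq.
Qed.

Lemma comp_if B F G : computableb B -> computable F -> computable G ->
  computable (fun x => if B x then F x else G x).
Proof.
move=> hB hF hG.
apply: comp_ext (comp_add (comp_mul (comp_bool hB) hF)
  (comp_mul (comp_bool (compb_neg hB)) hG)) => x /=.
by case: (B x); rewrite /= !(mul1n, mul0n, addn0).
Qed.

Lemma compb_app2 (f : nat -> nat -> bool) A B :
  computableb (fun z => f (cfst z) (csnd z)) -> computable A -> computable B ->
  computableb (fun x => f (A x) (B x)).
Proof. exact: (comp_app2 (f := fun x y => nat_of_bool (f x y))). Qed.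

Lemma compb_comp B A : computableb B -> computable A -> computableb (fun x => B (A x)).
Proof. exact: (comp_comp (F := fun x => nat_of_bool (B x))). Qed.

Lemma compb_all X P :
  computable X -> computableb (fun z => P (cfst z) (csnd z)) ->
  computableb (fun x => all (fun i => P i x) (iota 0 (X x))).
Proof.
move=> hX hP.
have h : computable (fun z => cfst (csnd z) * P (cfst z) (csnd (csnd z))).
  apply: comp_mul; first exact: comp_cfst (comp_csnd comp_id).
  exact: (compb_app2 hP (comp_cfst comp_id) (comp_csnd (comp_csnd comp_id))).
apply: comp_ext (comp_iteri (G := fun i r x => r * P i x) hX h (comp_const 1)) => x.
elim: (X x) => // n IHn.
by rewrite [iteri _ _ _]/= IHn -[in RHS]addn1 iotaD all_cat /= andbT mulnb.
Qed.

Lemma compb_has X P :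
  computable X -> computableb (fun z => P (cfst z) (csnd z)) ->
  computableb (fun x => has (fun i => P i x) (iota 0 (X x))).
Proof.
move=> hX hP; have := compb_neg (compb_all (P := fun i x => ~~ P i x) hX (compb_neg hP)).
by apply: compb_ext => x; rewrite -has_predC; apply: eq_has => i /=; rewrite negbK.
Qed.

Lemma comp_odd A : computable A -> computableb (fun x => odd (A x)).
Proof.
apply: (comp_comp (F := fun x => nat_of_bool (odd x))).
apply: comp_ext (comp_iter (G := fun r _ => 1 - r) comp_id
  (comp_sub (comp_const 1) (comp_cfst comp_id)) (comp_const 0)) => x.
by elim: x => //= n ->; case: (odd n).
Qed.

Lemma comp_half A : computable A -> computable (fun x => (A x)./2).
Proof.
apply: comp_comp.
apply: comp_ext (comp_iteri (G := fun i r _ => odd i + r) comp_id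
  (comp_add (comp_odd (comp_cfst comp_id)) (comp_cfst (comp_csnd comp_id)))
  (comp_const 0)) => x.
elim: x => //= n ->; by rewrite uphalf_half.
Qed.

Lemma comp_expn b A : computable A -> computable (fun x => b ^ A x).
Proof.
apply: comp_comp.
apply: comp_ext (comp_iter (G := fun r _ => b * r) comp_id
  (comp_mul (comp_const b) (comp_cfst comp_id)) (comp_const 1)) => x.
by elim: x => //= n ->; rewrite expnS.
Qed.

(** * Course-of-values recursion *)

Definition hist (G : nat -> nat -> nat -> nat) (p n : nat) : nat :=
  iteri n (fun i h => cpair (G p i h) h) 0.

Definition covrec (G : nat -> nat -> nat -> nat) (p n : nat) : nat :=
  G p n (hist G p n).

Definition past (n h i : nat) : nat := cfst (iter (n - i.+1) csnd h).

(** [hist] keeps the latest value outermost, so the value at [i] lies below [n - i.+1] tails. On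
    syntax trees the condition [i < n] holds because a positive tag makes the code of a term exceed
    those of its subterms. *)
Lemma past_hist G p n i : i < n -> past n (hist G p n) i = covrec G p i.
Proof.
rewrite /past; elim: n => // n IHn; rewrite ltnS subSS leq_eqVlt.
case/orP=> [/eqP->|lt_in].
  by rewrite subnn /= cfstK.
by rewrite -[n - i]prednK ?subn_gt0 // -subnS iterSr [hist _ _ _]/= csndK IHn.
Qed.

Lemma comp_covrec G A B :
  computable (fun z => G (cfst z) (cfst (csnd z)) (csnd (csnd z))) ->
  computable A -> computable B -> computable (fun x => covrec G (A x) (B x)).
Proof.
move=> hG; apply: comp_app2; rewrite /covrec.
have h1 := comp_cfst comp_id; have h2 := comp_csnd comp_id.
have h : computable (fun z => hist G (cfst z) (csnd z)).
  rewrite /hist.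
  apply: (comp_iteri (G := fun i h z => cpair (G (cfst z) i h) h)) => //; last exact: comp_const.
  apply: comp_cpair; last exact: comp_cfst h2.
  by apply: comp_app3 hG _ _ _ => //; apply: comp_cfst => //; apply: comp_csnd.
exact: comp_app3 hG h1 h2 h.
Qed.

Lemma comp_past A B C : computable A -> computable B -> computable C ->
  computable (fun x => past (A x) (B x) (C x)).
Proof.
apply: comp_app3; rewrite /past; apply: comp_cfst.
apply: (comp_iter (G := fun r _ => csnd r)).
- apply: comp_sub; first exact: comp_cfst comp_id.
  exact: comp_S (comp_csnd (comp_csnd comp_id)).
- exact: comp_csnd (comp_cfst comp_id).
- exact: comp_cfst (comp_csnd comp_id).
Qed.

Lemma comp_double A : computable A -> computable (fun x => (A x).*2).
Proof.
by move=> hA; apply: comp_ext (comp_add hA hA) => x; rewrite addnn.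
Qed.

(** * Coded rationals *)

(* Computability goals are solved by following the syntax of the function. Opaque constants keep the
   search from unfolding definitions that have their own closure lemma. *)
Create HintDb computability discriminated.
#[local] Hint Constants Opaque : computability.
#[local] Hint Resolve comp_id comp_const comp_S comp_add comp_mul comp_sub
  comp_pred comp_cpair comp_cfst comp_csnd comp_bool compb_leq compb_neg
  compb_and compb_or compb_eq comp_if compb_all compb_has comp_odd
  comp_half comp_expn comp_past comp_iteri comp_iter : computability.

(* The code [cpair p (cpair m d)] stands for the rational (p - m) / (d + 1), so
   that every natural number is the code of some rational and 0 codes 0. *)
Definition qpos (c : nat) : nat := cfst c.
Definition qneg (c : nat) : nat := cfst (csnd c).
Definition qden (c : nat) : nat := (csnd (csnd c)).+1.
Definition qmk (p m d : nat) : nat := cpair p (cpair m d.-1).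

Definition qval (c : nat) : rat := (((qpos c)%:R - (qneg c)%:R) / (qden c)%:R)%R.

Lemma qval_mk p m d : 0 < d -> qval (qmk p m d) = ((p%:R - m%:R) / d%:R)%R.
Proof.
by move=> d0; rewrite /qval /qpos /qneg /qden /qmk !(cfstK, csndK) prednK.
Qed.

Lemma qden_neq0 c : ((qden c)%:R != 0 :> rat)%R.
Proof. by rewrite pnatr_eq0. Qed.

Definition qadd a b :=
  qmk (qpos a * qden b + qpos b * qden a) (qneg a * qden b + qneg b * qden a)
      (qden a * qden b).
Definition qsub a b :=
  qmk (qpos a * qden b + qneg b * qden a) (qneg a * qden b + qpos b * qden a)
      (qden a * qden b).
Definition qmul a b :=
  qmk (qpos a * qpos b + qneg a * qneg b) (qpos a * qneg b + qneg a * qpos b)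
      (qden a * qden b).
(** Cross-multiplied comparison with every negative term moved to the other side, so that no
    truncated subtraction occurs. *)
Definition qle a b :=
  qpos a * qden b + qneg b * qden a <= qpos b * qden a + qneg a * qden b.
Definition qnat n := qmk n 0 1.

Lemma qval_add a b : qval (qadd a b) = (qval a + qval b)%R.
Proof.
rewrite qval_mk ?muln_gt0 // !natrD !natrM /qval; field.
by rewrite !qden_neq0.
Qed.

Lemma qval_sub a b : qval (qsub a b) = (qval a - qval b)%R.
Proof.
rewrite qval_mk ?muln_gt0 // !natrD !natrM /qval; field.
by rewrite !qden_neq0.
Qed.

Lemma qval_mul a b : qval (qmul a b) = (qval a * qval b)%R.
Proof.
rewrite qval_mk ?muln_gt0 // !natrD !natrM /qval; field.
by rewrite !qden_neq0.
Qed.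

Lemma qval_le a b : (qval a <= qval b)%R = qle a b.
Proof.
rewrite /qval ler_pdivrMr ?ltr0n // mulrAC ler_pdivlMr ?ltr0n //.
rewrite !mulrBl lerBlDr addrAC lerBrDr /qle.
by rewrite -!natrM -!natrD ler_nat.
Qed.

Lemma qval_nat n : qval (qnat n) = n%:R%R.
Proof. by rewrite qval_mk // subr0 divr1. Qed.

Lemma qval0 : qval 0 = 0%R.
Proof. exact: (qval_nat 0). Qed.

Lemma comp_qmk A B C : computable A -> computable B -> computable C ->
  computable (fun x => qmk (A x) (B x) (C x)).
Proof. rewrite /qmk; auto 20 with computability nocore. Qed.
#[local] Hint Resolve comp_qmk : computability.

Lemma comp_qpos A : computable A -> computable (fun x => qpos (A x)).
Proof. exact: comp_cfst. Qed.
Lemma comp_qneg A : computable A -> computable (fun x => qneg (A x)).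
Proof. rewrite /qneg; auto 20 with computability nocore. Qed.
Lemma comp_qden A : computable A -> computable (fun x => qden (A x)).
Proof. rewrite /qden; auto 20 with computability nocore. Qed.
#[local] Hint Resolve comp_qpos comp_qneg comp_qden : computability.

Lemma comp_qadd A B : computable A -> computable B ->
  computable (fun x => qadd (A x) (B x)).
Proof. rewrite /qadd; auto 20 with computability nocore. Qed.
Lemma comp_qsub A B : computable A -> computable B ->
  computable (fun x => qsub (A x) (B x)).
Proof. rewrite /qsub; auto 20 with computability nocore. Qed.
Lemma comp_qmul A B : computable A -> computable B ->
  computable (fun x => qmul (A x) (B x)).
Proof. rewrite /qmul; auto 20 with computability nocore. Qed.
Lemma comp_qle A B : computable A -> computable B ->
  computableb (fun x => qle (A x) (B x)).
Proof. rewrite /qle; auto 20 with computability nocore. Qed.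
Lemma comp_qnat A : computable A -> computable (fun x => qnat (A x)).
Proof. rewrite /qnat; auto 20 with computability nocore. Qed.
#[local] Hint Resolve comp_qadd comp_qsub comp_qmul comp_qle comp_qnat : computability.

(** [Negz n] is -(n+1), whence the extra successor on odd codes. *)
Definition abs_enc (z : nat) : nat := if odd z then z./2.+1 else z./2.

Definition q_of_enc (r : nat) : nat :=
  qmk (if odd (cfst r) then 0 else abs_enc (cfst r))
      (if odd (cfst r) then abs_enc (cfst r) else 0) (csnd r)./2.

Lemma comp_abs_enc A : computable A -> computable (fun x => abs_enc (A x)).
Proof. rewrite /abs_enc; auto 20 with computability nocore. Qed.
#[local] Hint Resolve comp_abs_enc : computability.

Lemma comp_q_of_enc A : computable A -> computable (fun x => q_of_enc (A x)).
Proof. rewrite /q_of_enc; auto 20 with computability nocore. Qed.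
#[local] Hint Resolve comp_q_of_enc : computability.

Lemma abs_encE z : abs_enc (enc_int z) = `|z|%N.
Proof.
case: z => n; rewrite /abs_enc /= ?odd_double ?doubleK //=.
by rewrite uphalf_double.
Qed.

Lemma enc_denq q : enc_int (denq q) = `|denq q|.*2.
Proof. by have := denq_gt0 q; case: (denq q). Qed.

Lemma qval_enc q : qval (q_of_enc (enc_rat q)) = q.
Proof.
rewrite /q_of_enc /enc_rat cfstK csndK enc_denq doubleK abs_encE.
rewrite qval_mk ?absz_gt0 ?denq_neq0 // -[RHS](divq_num_den q).
rewrite -[denq q in RHS]gtz0_abs ?denq_gt0 //; congr (_ / _)%R.
case: (numq q) => n /=; rewrite ?odd_double /= ?subr0 // sub0r.
by rewrite NegzE mulrNz.
Qed.

(** * Recognition of codes of rationals *)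

Definition dvd_in (i m : nat) : bool := has (fun a => i * a == m) (iota 0 m.+1).

Lemma dvd_inE i m : 0 < i -> dvd_in i m = (i %| m).
Proof.
move=> i0; apply/hasP/dvdnP => [[a _ /eqP<-]|[a ->]]; first by exists a; rewrite mulnC.
exists a; last by rewrite mulnC.
by rewrite mem_iota /= add0n ltnS leq_pmulr.
Qed.

Lemma comp_dvd_in A B : computable A -> computable B ->
  computableb (fun x => dvd_in (A x) (B x)).
Proof.
apply: (compb_app2 (f := dvd_in)).
rewrite /dvd_in; auto 20 with computability nocore.
Qed.
#[local] Hint Resolve comp_dvd_in : computability.

(** [enc_rat] yields only reduced fractions with positive denominator, whose code is even and
    nonzero. Candidate divisors [i.+2] leave out 1, and the denominator bounds the search. *)
Definition is_rat (r : nat) : bool :=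
  [&& ~~ odd (csnd r), csnd r != 0 &
      all (fun i => ~~ (dvd_in i.+2 (abs_enc (cfst r)) && dvd_in i.+2 (csnd r)./2))
          (iota 0 (csnd r)./2)].

Lemma comp_is_rat A : computable A -> computableb (fun x => is_rat (A x)).
Proof.
apply: compb_comp; rewrite /is_rat; auto 20 with computability nocore.
Qed.
#[local] Hint Resolve comp_is_rat : computability.

Lemma coprime_bounded m n : 0 < n ->
  all (fun i => ~~ ((i.+2 %| m) && (i.+2 %| n))) (iota 0 n) = coprime m n.
Proof.
move=> n0; apply/allP/idP => [h|cmn i _].
  have g0 : 0 < gcdn m n by rewrite gcdn_gt0 n0 orbT.
  have gn : gcdn m n <= n by rewrite dvdn_leq ?dvdn_gcdr.
  apply/eqP; case e : (gcdn m n) g0 gn => [//|[//|i]] _ gn.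
  have /h/negP[] : i \in iota 0 n by rewrite mem_iota /=; lia.
  by rewrite -e dvdn_gcdl dvdn_gcdr.
apply/negP => /andP[h1 h2].
by have := dvdn_gcd i.+2 m n; rewrite h1 h2 (eqP cmn).
Qed.

Lemma is_ratP r : reflect (exists q, enc_rat q = r) (is_rat r).
Proof.
have e : is_rat r = [&& ~~ odd (csnd r), csnd r != 0 &
    coprime (abs_enc (cfst r)) (csnd r)./2].
  rewrite /is_rat; case: (boolP (odd _)) => //= od.
  case: (eqVneq (csnd r) 0) => //= r0.
  rewrite -coprime_bounded; first by apply: eq_all => i; rewrite !dvd_inE.
  by rewrite half_gt0; case: (csnd r) od r0 => [|[]].
rewrite e; apply: (iffP and3P) => [[od d0 cop]|[q <-]]; last first.
  rewrite /enc_rat cfstK csndK enc_denq odd_double doubleK abs_encE.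
  split=> //; last exact: coprime_num_den.
  by rewrite double_eq0 absz_eq0 denq_neq0.
have [z ez] : exists z, enc_int z = cfst r.
  exists (if odd (cfst r) then Negz (cfst r)./2 else Posz (cfst r)./2).
  by have := odd_double_half (cfst r); case: ifP.
have ed : csnd r = (csnd r)./2.*2.
  by have := odd_double_half (csnd r); rewrite (negbTE od).
have h0 : 0 < (csnd r)./2 by rewrite lt0n -double_eq0 -ed.
exists (z%:~R / (Posz (csnd r)./2)%:~R)%R.
rewrite -[RHS]cpair_unpair -ez ed; move: cop; rewrite -ez abs_encE.
move: (csnd r)./2 h0 => d hd cop; rewrite /enc_rat.
rewrite doubleK coprimeq_num // coprimeq_den // gtr0_sg // mul1r.
by case: d hd {cop}.
Qed.

(** * Running time as a sum of surviving masses *)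

Local Open Scope ring_scope.

Definition is_bot (P : prog) : bool := if P is PBot then true else false.

Lemma is_botP P : reflect (P = PBot) (is_bot P).
Proof. by case: P => *; constructor. Qed.

(** Merges the cases of a probabilistic choice: the branches always receive [a * clamp p] and
    [a * (1 - clamp p)]. *)
Definition clamp (q : rat) : rat :=
  if q <= 0 then 0 else if 1 <= q then 1 else q.

Lemma clamp_itv q : 0 <= clamp q <= 1.
Proof. by rewrite /clamp; case: (lerP q 0) => h1; [|case: (lerP 1 q) => h2]; lra. Qed.

Definition seq_after (P2 : prog) (s : estate) : estate :=
  EState (PSeq (es_prog s) P2) (es_val s) (es_prob s) (es_word s).

(* Every state gets exactly two successors, indexed by a bit; those that are
   not reachable by [step] have probability 0. *)
Fixpoint successor_from (f : scheduler) (b : bool) (P : prog) (eta : valuation)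
    (a : rat) (w : list letter) : estate :=
  let a' := if b then 0 else a in
  match P with
  | PBot => EState PBot eta a' w
  | PAssign v e => EState PBot (upd eta v (aeval eta e)) a' w
  | PSeq P1 P2 =>
      if is_bot P1 then EState P2 eta a' w
      else seq_after P2 (successor_from f b P1 eta a w)
  | PProb P1 p P2 =>
      if b then EState P2 eta (a * (1 - clamp (aeval eta p))) (w ++ [:: Rp])
      else EState P1 eta (a * clamp (aeval eta p)) (w ++ [:: Lp])
  | PNondet P1 P2 =>
      if f w then EState P1 eta a' (w ++ [:: Ln])
      else EState P2 eta a' (w ++ [:: Rn])
  | PWhile c P =>
      if beval eta c then EState (PSeq P (PWhile c P)) eta a' w
      else EState PBot eta a' w
  end.

Definition successor (f : scheduler) (b : bool) (s : estate) : estate :=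
  successor_from f b (es_prog s) (es_val s) (es_prob s) (es_word s).

Lemma successor_prob f s : es_prob (successor f false s) + es_prob (successor f true s) = es_prob s.
Proof.
case: s => P eta a w; rewrite /successor /=; elim: P => //=.
- by rewrite addr0.
- by move=> *; rewrite addr0.
- by move=> P1 IH1 P2 IH2; case: ifP => //= _; rewrite addr0.
- by move=> *; ring.
- by move=> *; case: ifP => //= _; rewrite addr0.
- by move=> *; case: ifP => //= _; rewrite addr0.
Qed.

Lemma successor_ge0 f b s : 0 <= es_prob s -> 0 <= es_prob (successor f b s).
Proof.
case: s => P eta a w; rewrite /successor /= => a0.
have a0' : 0 <= (if b then 0 else a) by case: b.
elim: P => //=.
- by move=> P1 IH1 P2 IH2; case: ifP.
- move=> P1 _ p P2 _; have := clamp_itv (aeval eta p).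
  by case: b {a0'} => /= /andP[h1 h2]; rewrite mulr_ge0 // subr_ge0.
- by move=> *; case: ifP.
- by move=> *; case: ifP.
Qed.

(** Padding successors have probability 0, while [step] multiplies by positive factors only. From a
    state of positive mass, the successors of positive mass are thus exactly the steps. *)
Lemma stepE f s t : 0 < es_prob s ->
  step f s t <-> ~~ is_bot (es_prog s) /\
    exists b, t = successor f b s /\ 0 < es_prob t.
Proof.
move=> s0; split.
  move=> st; elim: st s0 => /=; rewrite /successor /=.
  - by move=> v e eta a w a0; split=> //; exists false.
  - move=> P1 P1' P2 eta eta' a a' w w' _ IH /IH[nb [b [e e0]]].
    by split=> //; exists b; rewrite (negbTE nb) -e.
  - by move=> P2 eta a w a0; split=> //; exists false.
  - move=> P1 p P2 eta a w hp a0; split=> //; exists true.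
    by rewrite /clamp hp subr0 mulr1.
  - move=> P1 p P2 eta a w hp a0; split=> //; exists false.
    by rewrite /clamp hp ifF ?mulr1 //; lra.
  - move=> P1 p P2 eta a w /andP[hp0 hp1] a0; split=> //; exists false.
    by rewrite /clamp !ifF ?mulr_gt0 //; lra.
  - move=> P1 p P2 eta a w /andP[hp0 hp1] a0; split=> //; exists true.
    by rewrite /clamp !ifF ?mulr_gt0 //; lra.
  - by move=> P1 P2 eta a w fw a0; split=> //; exists false; rewrite fw.
  - by move=> P1 P2 eta a w fw a0; split=> //; exists false; rewrite fw.
  - by move=> c P eta a w h a0; split=> //; exists false; rewrite h.
  - by move=> c P eta a w h a0; split=> //; exists false; rewrite h.
case: s s0 => P eta a w /= a0 [nb [b [-> {t}]]]; rewrite /successor /=.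
elim: P nb => //=.
- by move=> v e _; case: b => /=; rewrite ?ltxx // => _; constructor.
- move=> P1 IH1 P2 IH2 _.
  case: is_botP => [->|/is_botP nb /=].
    by case: b {IH1 IH2} => /=; rewrite ?ltxx // => _; constructor.
  move=> /(IH1 nb); case: (successor_from f b P1 eta a w) => *; exact: st_seq.
- move=> P1 _ p P2 _ _; rewrite /clamp.
  case: b; case: ifPn => h1 /=; rewrite ?(subr0, mulr0, mulr1, ltxx) //.
  + by move=> _; apply: st_prob_le0.
  + case: ifPn => h2; first by rewrite subrr mulr0 ltxx.
    by move=> _; apply: st_prob_R; rewrite !ltNge h1 h2.
  + case: ifPn => h2; first by rewrite mulr1 => _; apply: st_prob_ge1.
    by move=> _; apply: st_prob_L; rewrite !ltNge h1 h2.
- move=> P1 _ P2 _ _; case fw: (f w); case: b => /=; rewrite ?ltxx // => _;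
  by constructor.
- move=> c P1 _ _; case fw: (beval eta c); case: b => /=; rewrite ?ltxx // => _;
  by constructor.
Qed.

(** * Surviving mass and reached terminal states *)

Fixpoint alive (f : scheduler) (k : nat) (s : estate) : rat :=
  if is_bot (es_prog s) then 0 else
  if k is k'.+1 then alive f k' (successor f false s) + alive f k' (successor f true s)
  else es_prob s.

Lemma alive_ge0 f k s : 0 <= es_prob s -> 0 <= alive f k s.
Proof.
elim: k s => [|k IHk] s s0 /=; case: ifP => // _.
by rewrite addr_ge0 // IHk // successor_ge0.
Qed.

Lemma alive_le f k s : 0 <= es_prob s -> alive f k s <= es_prob s.
Proof.
elim: k s => [|k IHk] s s0 /=; case: ifP => // _.
by rewrite -(successor_prob f s) lerD // IHk // successor_ge0.
Qed.

Lemma alive_prob0 f k s : es_prob s = 0 -> alive f k s = 0.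
Proof.
move=> s0; apply/eqP; rewrite eq_le -{1}s0.
by rewrite alive_le ?alive_ge0 ?s0.
Qed.

Fixpoint leaves (f : scheduler) (k : nat) (s : estate) : seq {classic estate} :=
  if es_prob s == 0 then [::] else
  if is_bot (es_prog s) then [:: s] else
  if k is k'.+1 then leaves f k' (successor f false s) ++ leaves f k' (successor f true s)
  else [::].

Lemma leaves_alive f k s :
  \sum_(t <- leaves f k s) es_prob t + alive f k s = es_prob s.
Proof.
elim: k s => [|k IHk] s.
  rewrite /=; case: eqP => [->|_]; first by rewrite big_nil add0r; case: ifP.
  by case: ifP => _; rewrite ?big_seq1 ?big_nil ?addr0 ?add0r.
have [s0|s0] := eqVneq (es_prob s) 0.
  by rewrite alive_prob0 //= s0 eqxx big_nil addr0.
rewrite /= (negbTE s0); case: ifP => _; first by rewrite big_seq1 addr0.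
by rewrite big_cat /= -(successor_prob f s) -!IHk; ring.
Qed.

Lemma successor_word f b s : exists u, es_word (successor f b s) = es_word s ++ u.
Proof.
case: s => P eta a w; rewrite /successor /=; elim: P => /=.
- by exists [::]; rewrite cats0.
- by exists [::]; rewrite cats0.
- move=> P1 IH1 P2 IH2; case: ifP => //= _.
  by exists [::]; rewrite cats0.
- by move=> *; case: (b) => /=; eexists.
- by move=> *; case: ifP => /=; eexists.
- by move=> *; case: ifP => /= _; exists [::]; rewrite cats0.
Qed.

(** Only a probabilistic choice gives mass to both successors, and it appends different letters.
    Since words only grow, the two subtrees share no state; [T_le] is a set, so repeated leaves
    would be counted once. *)
Lemma successor_fork f s :
  es_prob (successor f false s) != 0 -> es_prob (successor f true s) != 0 ->
  es_word (successor f false s) = es_word s ++ [:: Lp] /\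
  es_word (successor f true s) = es_word s ++ [:: Rp].
Proof.
case: s => P eta a w; rewrite /successor /=; elim: P => /=; rewrite ?eqxx //.
- by move=> P1 IH1 P2 IH2; case: ifP => //=; rewrite eqxx.
- by move=> P1 _ P2 _; case: ifP => /= _ _; rewrite ?eqxx.
- by move=> c P1 _; case: ifP => /= _ _; rewrite ?eqxx.
Qed.

Lemma leaves_prob0 f k s : es_prob s = 0 -> leaves f k s = [::].
Proof. by case: k => [|k] /= ->; rewrite eqxx. Qed.

Lemma leaves_word f k s t : t \in leaves f k s ->
  exists u, es_word t = es_word s ++ u.
Proof.
elim: k s => [|k IHk] s /=; (case: ifP => // _; case: ifP => // _).
- by rewrite inE => /eqP->; exists [::]; rewrite cats0.
- by rewrite inE => /eqP->; exists [::]; rewrite cats0.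
have h b : t \in leaves f k (successor f b s) -> exists u, es_word t = es_word s ++ u.
  by move=> /IHk[u ->]; have [v ->] := successor_word f b s; exists (v ++ u); rewrite catA.
by rewrite mem_cat => /orP[]; apply: h.
Qed.

Lemma leaves_uniq f k s : uniq (leaves f k s).
Proof.
elim: k s => [|k IHk] s /=; case: ifP => // _; case: ifP => // _.
rewrite cat_uniq !IHk andbT /=; apply/hasPn => t tr; apply/negP => tl.
have nz b : t \in leaves f k (successor f b s) -> es_prob (successor f b s) != 0.
  by apply: contraTneq => /leaves_prob0 ->.
have [e1 e2] := successor_fork (nz _ tl) (nz _ tr).
have [u1 h1] := leaves_word tl; have [u2 h2] := leaves_word tr.
move: h2; rewrite h1 e1 e2 -!catA => /(congr1 (drop (size (es_word s)))).
by rewrite !drop_size_cat.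
Qed.

(** [stepn f n] makes [n.+1] steps, hence the strict bound. A terminal start has to be excluded:
    [leaves] lists it, yet no step leads to it. *)
Lemma mem_leaves f k s t : 0 < es_prob s -> ~~ is_bot (es_prog s) ->
  t \in leaves f k s <-> terminal t /\ exists n, (n < k)%N /\ stepn f n s t.
Proof.
elim: k s => [|k IHk] s s0 sb.
  rewrite /= gt_eqF // (negbTE sb); split=> // -[_ [n []]]; by rewrite ltn0.
rewrite [leaves _ _ _]/= gt_eqF // (negbTE sb) mem_cat; split.
  move=> h; have {h}[b hb] : exists b, t \in leaves f k (successor f b s).
    by case/orP: h; [exists false|exists true].
  have t0 : es_prob (successor f b s) != 0.
    by apply: contraTneq hb => /leaves_prob0 ->.
  have t0' : 0 < es_prob (successor f b s) by rewrite lt_def t0 successor_ge0 // ltW.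
  have st : step f s (successor f b s) by apply/stepE => //; split=> //; exists b.
  have [tb|tb] := boolP (is_bot (es_prog (successor f b s))).
    have -> : t = successor f b s.
      by move: hb; case: (k) => [|?] /=; rewrite (negbTE t0) tb inE => /eqP.
    by split; [exact/is_botP|exists 0].
  have [tt [n [nk hn]]] := (IHk _ t0' tb).1 hb.
  by split=> //; exists n.+1; split=> //; exists (successor f b s).
case=> tt [n [nk hn]].
suff [b hb] : exists b, t \in leaves f k (successor f b s).
  by case: b hb => ->; rewrite ?orbT.
case: n nk hn => [|n] nk /=.
  case/(stepE f t s0) => _ [b [e e0]]; exists b; rewrite -e.
  have tb : is_bot (es_prog t) by apply/is_botP.
  by case: (k) => [|?] /=; rewrite gt_eqF // tb inE.
case=> u [/(stepE f u s0)[_ [b [e e0]]] hn]; exists b; rewrite -e.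
apply/IHk => //; last by split=> //; exists n.
apply/negP => ub; case: n nk hn => [|n] nk /=; first by case/(stepE f t e0); rewrite ub.
by case=> v [/(stepE f v e0)[]]; rewrite ub.
Qed.

Lemma leaves_ge0 f k s t : 0 <= es_prob s -> t \in leaves f k s -> 0 <= es_prob t.
Proof.
elim: k s => [|k IHk] s s0 /=; (case: ifP => // _; case: ifP => // _).
- by rewrite inE => /eqP->.
- by rewrite inE => /eqP->.
- by rewrite mem_cat => /orP[]; apply: IHk; apply: successor_ge0.
Qed.

Definition runtime (f : scheduler) (N : nat) (s : estate) : rat :=
  \sum_(k < N) alive f k s.

Lemma ratr_leaves f k s :
  (\sum_(t <- leaves f k s) Prob t + ratr (alive f k s) = ratr (es_prob s) :> R)%R.
Proof. by rewrite -(leaves_alive f k s) rmorphD rmorph_sum. Qed.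

Lemma ExpRuntimeE f P : ~~ is_bot P ->
  ExpRuntime (init_pstate P) f =
  (\esum_(k in [set: nat]) (ratr (alive f k (init_estate (init_pstate P))) : R)%:E)%E.
Proof.
move=> nb; rewrite /ExpRuntime; apply: eq_esum => k _.
set s := init_estate _.
have -> : T_le k (init_pstate P) f = [set` leaves f k s]%classic.
  apply/seteqP; split=> t /=.
    case=> tt [n [n0 [nk hn]]]; apply/mem_leaves => //; split=> //.
    by exists n.-1; split=> //; rewrite prednK.
  by case/mem_leaves => // tt [n [nk hn]]; split=> //; exists n.+1.
have Prob_ge0 t : t \in leaves f k s -> 0 <= Prob t.
  move=> ht; rewrite /Prob ler0q.
  exact: leaves_ge0 ht.
rewrite esum_fset; last by move=> t; rewrite inE /= lee_fin; apply: Prob_ge0.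
  rewrite -fsbig_seq ?leaves_uniq // sumEFin -EFinB; congr EFin.
  have := ratr_leaves f k s; rewrite /= rmorph1 => <-.
  by rewrite addrC addKr.
exact: finite_seq.
Qed.

Lemma runtime_esum (u : nat -> rat) : (forall k, 0 <= u k) ->
  (exists n : nat, \esum_(k in [set: nat]) (ratr (u k) : R)%:E < (n%:R)%:E)%E <->
  (exists B : nat, forall N, \sum_(k < N) u k <= B%:R).
Proof.
move=> u0; have u0' k : (0 <= (ratr (u k) : R)%:E)%E by rewrite lee_fin ler0q.
have e N : (\sum_(0 <= k < N) (ratr (u k) : R)%:E)%E = (ratr (\sum_(k < N) u k))%:E.
  by rewrite sumEFin big_mkord rmorph_sum.
(* The successor on the way back turns a weak bound on the partial sums into a strict bound on the
   limit. *)
rewrite -nneseries_esumT //; split=> -[B hB]; [exists B|exists B.+1] => [N|].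
  have := le_lt_trans (nneseries_lim_ge (P := xpredT) N (fun k _ _ => u0' k)) hB.
  rewrite e lte_fin -(ratr_nat R B) ltr_rat; exact: ltW.
apply: (@le_lt_trans _ _ (B%:R)%:E); last by rewrite lte_fin ltr_nat.
apply: lime_le; first exact: is_cvg_nneseries.
by apply: nearW => N; rewrite e lee_fin -(ratr_nat R B) ler_rat.
Qed.

(** The conjunct on [is_bot] reflects that [T_le] demands at least one step. None leaves [PBot], so
    every term of its series is 1 and its expected time is infinite. *)
Lemma PAST_runtime P : PAST P <-> ~~ is_bot P /\
  forall f, exists B : nat, forall N,
    runtime f N (init_estate (init_pstate P)) <= B%:R.
Proof.
have [/is_botP->|nb] := boolP (is_bot P).
  split=> [/(_ (fun=> true))[n]|[]//]; rewrite ltNge => /negP[].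
  rewrite /ExpRuntime; apply: esum_ge.
  exists [set` iota 0 n]%classic; first by split=> //; exact: finite_seq.
  rewrite -fsbig_seq ?iota_uniq //.
  have noT k : T_le k (init_pstate PBot) (fun=> true) = set0.
    by apply/seteqP; split=> // t [_ [[|[|m]] [//= _ [_]]]] => [|[u []]] h; inversion h.
  under eq_bigr do rewrite noT esum_set0 sube0.
  rewrite sumEFin lee_fin big_const_seq count_predT size_iota.
  by rewrite iter_addr_0.
have e f := runtime_esum
  (u := fun k => alive f k (init_estate (init_pstate P)))
  (fun k => alive_ge0 f k (isT : 0 <= es_prob (init_estate (init_pstate P)))).
split=> [h|[_ h] f]; first split=> // f.
  by apply: (e f).1; have := h f; rewrite ExpRuntimeE.
by rewrite ExpRuntimeE //; apply: (e f).2; apply: h.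
Qed.

Local Close Scope ring_scope.

(** * A recursive interpreter *)

Definition code_tail (s : nat) : nat := csnd s.-1.
Definition code_nth (s i : nat) : nat := cfst (iter i code_tail s).-1.

Lemma code_drop l i : iter i code_tail (seq_code l) = seq_code (drop i l).
Proof.
elim: i l => [|i IHi] l; first by rewrite drop0.
rewrite iterSr; case: l => [|x l]; last by rewrite /= -IHi /code_tail csndK.
by elim: i {IHi} => //= i ->.
Qed.

Lemma code_nthE l i : code_nth (seq_code l) i = nth 0 l i.
Proof.
rewrite /code_nth code_drop -[in RHS](addn0 i) -nth_drop.
by case: (drop i l) => [|x l'] //=; rewrite cfstK.
Qed.

(** Codes of nonempty lists are successors, and dropping past the end stays at 0. This is how a
    recursive predicate compares an index with the length of a coded prefix. *)
Lemma code_drop_neq0 l i : (iter i code_tail (seq_code l) != 0) = (i < size l).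
Proof.
rewrite code_drop -subn_gt0 -size_drop.
by case: (drop i l).
Qed.

Lemma size_seq_code l : size l <= seq_code l.
Proof.
elim: l => //= x l IHl; rewrite ltnS; apply: leq_trans IHl _.
by apply: leq_trans (cpair_ge _ _); apply: leq_addl.
Qed.

Lemma comp_code_tail A : computable A -> computable (fun x => code_tail (A x)).
Proof. rewrite /code_tail; auto 20 with computability nocore. Qed.
#[local] Hint Resolve comp_code_tail : computability.

Lemma comp_code_drop A B : computable A -> computable B ->
  computable (fun x => iter (A x) code_tail (B x)).
Proof.
by move=> hA hB; apply: (comp_iter (G := fun r _ => code_tail r)) => //;
  auto 20 with computability nocore.
Qed.
#[local] Hint Resolve comp_code_drop : computability.

Lemma comp_code_nth A B : computable A -> computable B ->
  computable (fun x => code_nth (A x) (B x)).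
Proof. rewrite /code_nth; auto 20 with computability nocore. Qed.
#[local] Hint Resolve comp_code_nth : computability.

(** A valuation is coded by an association list, latest assignment first, with 0 for [eta0]. The
    recursion runs on the code of the list; the variable is the parameter. *)
Definition val_lookup_body (x e h : nat) : nat :=
  if e == 0 then 0 else
  if cfst (cfst e.-1) == x then csnd (cfst e.-1) else past e h (csnd e.-1).
Definition val_lookup (e x : nat) : nat := covrec val_lookup_body x e.
Definition val_upd (e x q : nat) : nat := (cpair (cpair x q) e).+1.

Lemma comp_val_lookup A B : computable A -> computable B ->
  computable (fun x => val_lookup (A x) (B x)).
Proof.
move=> hA hB; apply: comp_covrec => //.
rewrite /val_lookup_body; auto 20 with computability nocore.
Qed.
#[local] Hint Resolve comp_val_lookup : computability.

Lemma comp_val_upd A B C : computable A -> computable B -> computable C ->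
  computable (fun x => val_upd (A x) (B x) (C x)).
Proof. rewrite /val_upd; auto 20 with computability nocore. Qed.
#[local] Hint Resolve comp_val_upd : computability.

Definition val_code (e : nat) (eta : valuation) : Prop :=
  forall x, qval (val_lookup e x) = eta x.

Lemma val_code0 : val_code 0 eta0.
Proof. by move=> x; rewrite /val_lookup /covrec /val_lookup_body /= qval0. Qed.

Lemma val_lookup_upd e x q y :
  val_lookup (val_upd e x q) y = if x == y then q else val_lookup e y.
Proof.
rewrite {1}/val_lookup /covrec {1}/val_lookup_body past_hist.
  by rewrite /val_upd eqn0Ngt /= !(cfstK, csndK).
rewrite /val_upd /= csndK ltnS.
by apply: leq_trans (cpair_ge _ _); apply: leq_addl.
Qed.

Lemma val_code_upd e eta x q : val_code e eta ->
  val_code (val_upd e x q) (upd eta x (qval q)).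
Proof.
move=> he y; rewrite val_lookup_upd /upd; case: eqP => [->|ne].
  by rewrite eqxx.
by rewrite ifF; [exact: he|apply/eqP => /esym].
Qed.

Definition aexp_eval_body (eta n h : nat) : nat :=
  if cfst n == 0 then q_of_enc (csnd n) else
  if cfst n == 1 then val_lookup eta (csnd n) else
  if cfst n == 2 then
    qadd (past n h (cfst (csnd n))) (past n h (csnd (csnd n))) else
  if cfst n == 3 then
    qsub (past n h (cfst (csnd n))) (past n h (csnd (csnd n))) else
  qmul (past n h (cfst (csnd n))) (past n h (csnd (csnd n))).
Definition aexp_eval (eta n : nat) : nat := covrec aexp_eval_body eta n.

Lemma comp_aexp_eval A B : computable A -> computable B ->
  computable (fun x => aexp_eval (A x) (B x)).
Proof.
move=> hA hB; apply: comp_covrec => //.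
rewrite /aexp_eval_body; auto 30 with computability nocore.
Qed.
#[local] Hint Resolve comp_aexp_eval : computability.

Lemma past_fst G p t x y : 0 < t ->
  past (cpair t (cpair x y)) (hist G p (cpair t (cpair x y))) x = covrec G p x.
Proof.
move=> t0; rewrite past_hist //.
by have := cpair_gt (cpair x y) t0; have := cpair_ge x y; lia.
Qed.

Lemma past_snd G p t x y : 0 < t ->
  past (cpair t (cpair x y)) (hist G p (cpair t (cpair x y))) y = covrec G p y.
Proof.
move=> t0; rewrite past_hist //.
by have := cpair_gt (cpair x y) t0; have := cpair_ge x y; lia.
Qed.

Lemma past_arg G p t x : 0 < t ->
  past (cpair t x) (hist G p (cpair t x)) x = covrec G p x.
Proof. by move=> t0; rewrite past_hist //; apply: cpair_gt. Qed.

Lemma aexp_evalE v eta e : val_code v eta -> qval (aexp_eval v (enc_aexp e)) = aeval eta e.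
Proof.
move=> hv; rewrite /aexp_eval.
elim: e => [q|x|e1 IH1 e2 IH2|e1 IH1 e2 IH2|e1 IH1 e2 IH2] /=;
  rewrite /covrec /aexp_eval_body !(cfstK, csndK) /= ?past_fst ?past_snd //.
- exact: qval_enc.
- by rewrite qval_add IH1 IH2.
- by rewrite qval_sub IH1 IH2.
- by rewrite qval_mul IH1 IH2.
Qed.

Definition bexp_eval_body (eta n h : nat) : nat :=
  if cfst n == 0 then 1 else
  if cfst n == 1 then 0 else
  if cfst n == 2 then nat_of_bool
    (qle (aexp_eval eta (cfst (csnd n))) (aexp_eval eta (csnd (csnd n)))) else
  if cfst n == 3 then nat_of_bool
    (~~ qle (aexp_eval eta (csnd (csnd n))) (aexp_eval eta (cfst (csnd n)))) else
  if cfst n == 4 then nat_of_bool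
    (qle (aexp_eval eta (cfst (csnd n))) (aexp_eval eta (csnd (csnd n))) &&
     qle (aexp_eval eta (csnd (csnd n))) (aexp_eval eta (cfst (csnd n)))) else
  if cfst n == 5 then 1 - past n h (csnd n) else
  if cfst n == 6 then past n h (cfst (csnd n)) * past n h (csnd (csnd n)) else
  nat_of_bool (0 < past n h (cfst (csnd n)) + past n h (csnd (csnd n))).
Definition bexp_eval (eta n : nat) : nat := covrec bexp_eval_body eta n.

Lemma comp_bexp_eval A B : computable A -> computable B ->
  computable (fun x => bexp_eval (A x) (B x)).
Proof.
move=> hA hB; apply: comp_covrec => //.
rewrite /bexp_eval_body; auto 30 with computability nocore.
Qed.
#[local] Hint Resolve comp_bexp_eval : computability.

Lemma bexp_evalE v eta b : val_code v eta ->
  bexp_eval v (enc_bexp b) = beval eta b :> nat.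
Proof.
move=> hv; rewrite /bexp_eval.
elim: b => [||e1 e2|e1 e2|e1 e2|b IH|b1 IH1 b2 IH2|b1 IH1 b2 IH2] /=;
  rewrite /covrec /bexp_eval_body !(cfstK, csndK) /= -?qval_le ?(aexp_evalE _ hv) //.
- by rewrite ltNge.
- by rewrite -eq_le.
- by rewrite past_arg // IH; case: (beval eta b).
- by rewrite past_fst // past_snd // IH1 IH2 mulnb.
- by rewrite past_fst // past_snd // IH1 IH2; case: (beval eta b1); case: (beval eta b2).
Qed.

Definition letter_code (x : letter) : nat :=
  match x with Ln => 1 | Rn => 2 | Lp => 3 | Rp => 4 end.
Definition word_code (w : list letter) : nat :=
  foldl (fun c x => 5 * c + letter_code x) 0 w.

Lemma word_code_snoc w x : word_code (w ++ [:: x]) = 5 * word_code w + letter_code x.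
Proof. by rewrite /word_code foldl_cat. Qed.

Lemma word_code_lt w : word_code w < 5 ^ size w.
Proof.
elim/last_ind: w => // w x IHw.
rewrite -cats1 word_code_snoc size_cat addn1 expnS.
by move: (5 ^ size w) (word_code w) IHw => M c; case: x => /=; lia.
Qed.

(** The letters are the digits 1 to 4; omitting 0 keeps words of different lengths apart. *)
Lemma word_code_inj : injective word_code.
Proof.
have w0 : word_code [::] = 0 by [].
elim/last_ind => [|w x IHw]; elim/last_ind => [|w' x' _] //;
  rewrite -?cats1 ?word_code_snoc ?w0.
- by case: x' => /=; lia.
- by case: x => /=; lia.
have hx : letter_code x = letter_code x' -> x = x' by case: x; case: x'.
move=> e; have ex : letter_code x = letter_code x'.
  by move: e; case: x {hx}; case: x' => /=; lia.
by rewrite (IHw w') ?(hx ex) //; lia.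
Qed.

Definition state_code (p v a w : nat) : nat := cpair p (cpair v (cpair a w)).

Lemma comp_state_code A B C D : computable A -> computable B -> computable C ->
  computable D -> computable (fun x => state_code (A x) (B x) (C x) (D x)).
Proof. rewrite /state_code; auto 20 with computability nocore. Qed.
#[local] Hint Resolve comp_state_code : computability.

Definition qclamp (q : nat) : nat :=
  if qle q (qnat 0) then 0 else if qle (qnat 1) q then qnat 1 else q.

Lemma comp_qclamp A : computable A -> computable (fun x => qclamp (A x)).
Proof. rewrite /qclamp; auto 20 with computability nocore. Qed.
#[local] Hint Resolve comp_qclamp : computability.

Lemma qval_clamp q : qval (qclamp q) = clamp (qval q).
Proof.
rewrite /qclamp /clamp -!qval_le !qval_nat.
by case: ifP => _; [exact: qval0|case: ifP => _; rewrite ?qval_nat].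
Qed.

Definition next_body (s b v a w n h : nat) : nat :=
  if cfst n == 0 then state_code 0 v (if b == 0 then a else 0) w else
  if cfst n == 1 then
    state_code 0 (val_upd v (cfst (csnd n)) (aexp_eval v (csnd (csnd n))))
      (if b == 0 then a else 0) w else
  if cfst n == 2 then
    if cfst (csnd n) == 0 then
      state_code (csnd (csnd n)) v (if b == 0 then a else 0) w
    else cpair (cpair 2 (cpair (cfst (past n h (cfst (csnd n)))) (csnd (csnd n))))
      (csnd (past n h (cfst (csnd n)))) else
  if cfst n == 3 then
    if b == 0 then
      state_code (cfst (csnd n)) v
        (qmul a (qclamp (aexp_eval v (cfst (csnd (csnd n)))))) (5 * w + 3)
    else
      state_code (csnd (csnd (csnd n))) v
        (qmul a (qsub (qnat 1) (qclamp (aexp_eval v (cfst (csnd (csnd n)))))))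
        (5 * w + 4) else
  if cfst n == 4 then
    if code_nth s (2 * w) == 0 then
      state_code (cfst (csnd n)) v (if b == 0 then a else 0) (5 * w + 1)
    else state_code (csnd (csnd n)) v (if b == 0 then a else 0) (5 * w + 2) else
  if bexp_eval v (cfst (csnd n)) == 0 then state_code 0 v (if b == 0 then a else 0) w
  else state_code (cpair 2 (cpair (csnd (csnd n)) n)) v (if b == 0 then a else 0) w.

(* The course-of-values parameter packs the oracle, the bit and the state
   without its program, on which the recursion runs. *)
Definition code_next (s b c : nat) : nat :=
  covrec (fun p => next_body (cfst p) (cfst (csnd p)) (cfst (csnd (csnd p)))
    (cfst (csnd (csnd (csnd p)))) (csnd (csnd (csnd (csnd p)))))
    (cpair s (cpair b (csnd c))) (cfst c).

Lemma comp_code_next A B C : computable A -> computable B -> computable C ->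
  computable (fun x => code_next (A x) (B x) (C x)).
Proof.
move=> hA hB hC; apply: comp_covrec; last 2 first.
- auto 20 with computability nocore.
- auto 20 with computability nocore.
rewrite /next_body; auto 40 with computability nocore.
Qed.
#[local] Hint Resolve comp_code_next : computability.

Definition represents (c : nat) (st : estate) : Prop :=
  exists v a w, c = state_code (enc_prog (es_prog st)) v a w /\
    [/\ val_code v (es_val st), qval a = es_prob st & w = word_code (es_word st)].

(* Words are nonnegative base-5 numerals; the scheduler reads the even entries
   of the oracle, the odd ones being kept for the moduli. *)
Definition oracle_scheduler (beta : nat -> nat) : scheduler :=
  fun w => beta (2 * word_code w) == 0.

Lemma enc_prog_eq0 P : (enc_prog P == 0) = is_bot P.
Proof.
case: P => //= [x e|P1 P2|P1 p P2|P1 P2|c P1]; apply/negbTE; rewrite -lt0n;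
by apply: leq_trans (cpair_ge _ _).
Qed.

(** No length condition on [s] is imposed: beyond its end [code_nth] gives 0, and the interpreter
    still follows the scheduler [oracle_scheduler (code_nth s)]. Agreement with the intended
    scheduler is secured by the length tests in [PAST_check]. *)
Lemma code_nextE s b c st : represents c st ->
  represents (code_next s (nat_of_bool b) c) (successor (oracle_scheduler (code_nth s)) b st).
Proof.
case=> v [a [w [-> []]]]; rewrite /code_next /state_code csndK cfstK.
case: st => P eta q u /= hv ha -> {w}; rewrite /successor /=.
set G := fun p : nat => _; set pr := cpair s _.
have hb : qval (if nat_of_bool b == 0 then a else 0) = (if b then 0 else q)%R.
  by case: (b) => //=; rewrite qval0.
have eG P' : covrec G pr P' = next_body s b v a (word_code u) P' (hist G pr P').
  by rewrite /covrec {1}/G /pr !(cfstK, csndK).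
elim: P => [|x e|P1 IH1 P2 IH2|P1 IH1 p P2 IH2|P1 IH1 P2 IH2|g P IH] /=;
  rewrite eG /next_body !(cfstK, csndK) [_ == _]/=.
- by eexists v, _, _; split; [reflexivity|split].
- eexists _, _, _; split; [reflexivity|split=> //=].
  by rewrite -(aexp_evalE e hv); apply: val_code_upd.
- rewrite enc_prog_eq0; case: ifP => nb.
    by eexists v, _, _; split; [reflexivity|split].
  rewrite past_fst //.
  case: IH1 => v' [a' [w' [-> [h1 h2 h3]]]].
  by exists v', a', w'; split; [rewrite /state_code !(cfstK, csndK)|split].
- case: b hb pr eG IH1 IH2 => hb pr eG IH1 IH2 /=.
    eexists v, _, _; split; [reflexivity|split=> //=].
      by rewrite qval_mul qval_sub qval_nat qval_clamp (aexp_evalE _ hv) ha.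
    by rewrite word_code_snoc.
  eexists v, _, _; split; [reflexivity|split=> //=].
    by rewrite qval_mul qval_clamp (aexp_evalE _ hv) ha.
  by rewrite word_code_snoc.
- rewrite /oracle_scheduler; case: ifP => _;
  eexists v, _, _; (split; [reflexivity|split=> //=]);
  by rewrite word_code_snoc.
- rewrite (bexp_evalE _ hv); case: (beval eta g) => /=;
  by eexists v, _, _; (split; [reflexivity|split]).
Qed.

(** * Surviving mass as a computable sum *)

Fixpoint walk (f : scheduler) (k b : nat) (s : estate) : estate :=
  if k is k'.+1 then walk f k' b./2 (successor f (odd b) s) else s.

Lemma sum_even_odd (F : nat -> rat) n :
  (\sum_(b < n.*2) F b = \sum_(b < n) F b.*2 + \sum_(b < n) F b.*2.+1)%R.
Proof.
elim: n => [|n IHn]; first by rewrite !big_ord0 addr0.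
by rewrite doubleS !big_ord_recr /= IHn; ring.
Qed.

Definition leaf_prob (s : estate) : rat :=
  (if is_bot (es_prog s) then 0 else es_prob s)%R.

Lemma walk_bot f k b s : is_bot (es_prog s) -> is_bot (es_prog (walk f k b s)).
Proof.
elim: k b s => //= k IHk b s sb; apply: IHk.
by case: s sb => -[].
Qed.

(** [alive] recurses into two different states. Letting each [k]-bit number steer one path replaces
    this tree by a bounded sum of iterations; paths that stop early stay at [PBot] and contribute
    0. *)
Lemma alive_walk f k s : alive f k s = (\sum_(b < 2 ^ k) leaf_prob (walk f k b s))%R.
Proof.
elim: k s => [|k IHk] s /=; first by rewrite big_ord1.
case: ifP => sb.
  by rewrite big1 // => b _; rewrite /leaf_prob walk_bot //; case: s sb => -[].
rewrite expnS mul2n (sum_even_odd (fun b => leaf_prob (walk f k b./2 (successor f (odd b) s)))).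
rewrite !IHk; congr (_ + _)%R; apply: eq_bigr => b _.
  by rewrite odd_double doubleK.
by rewrite /= odd_double uphalf_double.
Qed.

Lemma successor_ext f g b s :
  (forall w, size w <= size (es_word s) -> f w = g w) ->
  successor f b s = successor g b s.
Proof.
case: s => P eta a w; rewrite /successor /= => h.
by elim: P => //= [P1 -> P2 _|P1 _ P2 _] //; rewrite h.
Qed.

Lemma successor_size f b s : size (es_word (successor f b s)) <= (size (es_word s)).+1.
Proof.
case: s => P eta a w; rewrite /successor /=.
by elim: P => //= [P1 IH P2 _|P1 _ p P2 _|P1 _ P2 _|c P _];
  case: ifP => //=; rewrite ?size_cat ?addn1.
Qed.

(** A step adds at most one letter, so after [j] steps, [j < k], the queried word is at most [j]
    letters longer than the initial one. *)
Lemma alive_ext f g k s :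
  (forall w, size w < size (es_word s) + k -> f w = g w) ->
  alive f k s = alive g k s.
Proof.
elim: k s => [|k IHk] s h //=; case: ifP => // _.
rewrite !(successor_ext (f := f) (g := g)); last 2 first.
- by move=> w hw; apply: h; apply: leq_ltn_trans hw _; rewrite -addSnnS leq_addr.
- by move=> w hw; apply: h; apply: leq_ltn_trans hw _; rewrite -addSnnS leq_addr.
congr (_ + _)%R; apply: IHk => w hw; apply: h; apply: leq_trans hw _;
by rewrite -addSnnS leq_add2r successor_size.
Qed.

Lemma runtime_ext f g N s :
  (forall w, size w < size (es_word s) + N -> f w = g w) ->
  runtime f N s = runtime g N s.
Proof.
move=> h; apply: eq_bigr => k _; apply: alive_ext => w hw; apply: h.
by apply: leq_trans hw _; rewrite leq_add2l ltnW.
Qed.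

Definition code_advance (s z : nat) : nat :=
  cpair (code_next s (nat_of_bool (odd (csnd z))) (cfst z)) (csnd z)./2.
Definition code_walk (s k b c : nat) : nat :=
  cfst (iter k (code_advance s) (cpair c b)).
Definition code_leaf_prob (c : nat) : nat :=
  if cfst c == 0 then 0 else cfst (csnd (csnd c)).
Definition code_alive (s c k : nat) : nat :=
  iteri (2 ^ k) (fun b r => qadd r (code_leaf_prob (code_walk s k b c))) 0.
Definition code_runtime (s c N : nat) : nat :=
  iteri N (fun k r => qadd r (code_alive s c k)) 0.

Lemma code_walkE s k b c st : represents c st ->
  represents (code_walk s k b c) (walk (oracle_scheduler (code_nth s)) k b st).
Proof.
rewrite /code_walk; elim: k b c st => [|k IHk] b c st h; first by rewrite /= cfstK.
rewrite iterSr [code_advance s (cpair c b)]/code_advance cfstK csndK /=; apply: IHk.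
exact: code_nextE.
Qed.

Lemma code_leaf_probE c st : represents c st -> qval (code_leaf_prob c) = leaf_prob st.
Proof.
case=> v [a [w [-> []]]]; rewrite /code_leaf_prob /leaf_prob /state_code.
rewrite !(cfstK, csndK) enc_prog_eq0 => _ ha _.
by case: ifP => // _; apply: qval0.
Qed.

Lemma qval_iteri (F : nat -> nat) n :
  qval (iteri n (fun i r => qadd r (F i)) 0) = (\sum_(i < n) qval (F i))%R.
Proof.
elim: n => [|n IHn]; first by rewrite big_ord0 qval0.
by rewrite /= qval_add IHn big_ord_recr.
Qed.

Lemma code_runtimeE s c N st : represents c st ->
  qval (code_runtime s c N) = runtime (oracle_scheduler (code_nth s)) N st.
Proof.
move=> h; rewrite /code_runtime qval_iteri; apply: eq_bigr => k _.
rewrite /code_alive qval_iteri alive_walk; apply: eq_bigr => b _.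
by apply/code_leaf_probE/code_walkE.
Qed.

Lemma comp_code_leaf_prob A : computable A -> computable (fun x => code_leaf_prob (A x)).
Proof. rewrite /code_leaf_prob; auto 20 with computability nocore. Qed.
#[local] Hint Resolve comp_code_leaf_prob : computability.

Lemma comp_code_walk A B C D : computable A -> computable B -> computable C ->
  computable D -> computable (fun x => code_walk (A x) (B x) (C x) (D x)).
Proof.
move=> hA hB hC hD; rewrite /code_walk; apply: comp_cfst.
apply: (comp_iter (G := fun r x => code_advance (A x) r)) => //; last first.
  auto 20 with computability nocore.
have hA' := comp_comp hA (comp_csnd comp_id).
rewrite /code_advance; auto 20 with computability nocore.
Qed.
#[local] Hint Resolve comp_code_walk : computability.

Lemma comp_code_alive A B C : computable A -> computable B -> computable C ->
  computable (fun x => code_alive (A x) (B x) (C x)).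
Proof.
apply: comp_app3; rewrite /code_alive.
apply: (comp_iteri (X := fun x => 2 ^ csnd (csnd x)) (A := fun=> 0)
  (G := fun b r x => qadd r (code_leaf_prob (code_walk (cfst x) (csnd (csnd x)) b
    (cfst (csnd x)))))); auto 20 with computability nocore.
Qed.
#[local] Hint Resolve comp_code_alive : computability.

Lemma comp_code_runtime A B C : computable A -> computable B -> computable C ->
  computable (fun x => code_runtime (A x) (B x) (C x)).
Proof.
apply: comp_app3; rewrite /code_runtime.
apply: (comp_iteri (X := fun x => csnd (csnd x)) (A := fun=> 0)
  (G := fun k r x => qadd r (code_alive (cfst x) (cfst (csnd x)) k)));
auto 20 with computability nocore.
Qed.
#[local] Hint Resolve comp_code_runtime : computability.

(** * Recognition of codes of programs *)

Definition is_aexp_body (p n h : nat) : nat :=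
  if cfst n == 0 then nat_of_bool (is_rat (csnd n)) else
  if cfst n == 1 then 1 else
  if cfst n <= 4 then past n h (cfst (csnd n)) * past n h (csnd (csnd n)) else 0.
Definition is_aexp (n : nat) : nat := covrec is_aexp_body 0 n.

Lemma comp_is_aexp A : computable A -> computable (fun x => is_aexp (A x)).
Proof.
move=> hA; apply: comp_covrec => //; last exact: comp_const.
rewrite /is_aexp_body; auto 20 with computability nocore.
Qed.
#[local] Hint Resolve comp_is_aexp : computability.

Definition is_bexp_body (p n h : nat) : nat :=
  if cfst n <= 1 then nat_of_bool (csnd n == 0) else
  if cfst n <= 4 then is_aexp (cfst (csnd n)) * is_aexp (csnd (csnd n)) else
  if cfst n == 5 then past n h (csnd n) else
  if cfst n <= 7 then past n h (cfst (csnd n)) * past n h (csnd (csnd n)) else 0.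
Definition is_bexp (n : nat) : nat := covrec is_bexp_body 0 n.

Lemma comp_is_bexp A : computable A -> computable (fun x => is_bexp (A x)).
Proof.
move=> hA; apply: comp_covrec => //; last exact: comp_const.
rewrite /is_bexp_body; auto 20 with computability nocore.
Qed.
#[local] Hint Resolve comp_is_bexp : computability.

Definition is_prog_body (p n h : nat) : nat :=
  if cfst n == 0 then nat_of_bool (csnd n == 0) else
  if cfst n == 1 then is_aexp (csnd (csnd n)) else
  if cfst n == 2 then past n h (cfst (csnd n)) * past n h (csnd (csnd n)) else
  if cfst n == 3 then past n h (cfst (csnd n)) *
    (is_aexp (cfst (csnd (csnd n))) * past n h (csnd (csnd (csnd n)))) else
  if cfst n == 4 then past n h (cfst (csnd n)) * past n h (csnd (csnd n)) else
  if cfst n == 5 then is_bexp (cfst (csnd n)) * past n h (csnd (csnd n)) else 0.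
Definition is_prog (n : nat) : nat := covrec is_prog_body 0 n.

Lemma comp_is_prog A : computable A -> computable (fun x => is_prog (A x)).
Proof.
move=> hA; apply: comp_covrec => //; last exact: comp_const.
rewrite /is_prog_body; auto 20 with computability nocore.
Qed.
#[local] Hint Resolve comp_is_prog : computability.

Lemma cpair_arg t x y : 0 < t -> x < cpair t (cpair x y) /\ y < cpair t (cpair x y).
Proof. by move=> /(cpair_gt (cpair x y)); have := cpair_ge x y; lia. Qed.

Lemma cpair_surj r : exists x y, r = cpair x y.
Proof. by exists (cfst r), (csnd r); rewrite cpair_unpair. Qed.

Lemma is_aexpP n : (exists e, enc_aexp e = n) <-> is_aexp n != 0.
Proof.
split=> [[e <-{n}]|].
  rewrite /is_aexp; elim: e => [q|x|e1 IH1 e2 IH2|e1 IH1 e2 IH2|e1 IH1 e2 IH2] /=;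
  rewrite /covrec /is_aexp_body !(cfstK, csndK) /= ?past_fst ?past_snd ?muln_eq0 ?negb_or ?IH1 //.
  by rewrite eqb0 negbK; apply/is_ratP; exists q.
elim/ltn_ind: n => n; rewrite -(cpair_unpair n); move: (cfst n) (csnd n) => {n} t r IH.
rewrite /is_aexp /covrec /is_aexp_body !(cfstK, csndK).
case: t IH => [_|[_ _|t IH]] /=.
- by rewrite eqb0 negbK => /is_ratP[q <-]; exists (AConst q).
- by exists (AVar r).
have [x [y er]] := cpair_surj r; subst r; rewrite !(cfstK, csndK).
have [h1 h2] := cpair_arg x y (isT : 0 < t.+2).
rewrite past_fst // past_snd //; case: ifP => // t4.
rewrite muln_eq0 negb_or => /andP[/(IH _ h1)[e1 <-] /(IH _ h2)[e2 <-]].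
case: t t4 {h1 h2 IH} => [|[|[|//]]] _.
- by exists (AAdd e1 e2).
- by exists (ASub e1 e2).
- by exists (AMul e1 e2).
Qed.

Lemma is_bexpP n : (exists b, enc_bexp b = n) <-> is_bexp n != 0.
Proof.
have ha e : is_aexp (enc_aexp e) != 0 by apply/is_aexpP; exists e.
split=> [[e <-{n}]|].
  rewrite /is_bexp; elim: e => [||e1 e2|e1 e2|e1 e2|e IH|e1 IH1 e2 IH2|e1 IH1 e2 IH2] /=;
  rewrite /covrec /is_bexp_body ?(cfstK, csndK) /= ?past_arg ?past_fst ?past_snd //;
  by rewrite ?muln_eq0 ?negb_or ?IH1 ?IH2 ?ha.
elim/ltn_ind: n => n; rewrite -(cpair_unpair n); move: (cfst n) (csnd n) => {n} t r IH.
rewrite /is_bexp /covrec /is_bexp_body !(cfstK, csndK).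
case: (leqP t 1) => t1.
  rewrite eqb0 negbK => /eqP->; case: t t1 {IH} => [|[|//]] _.
    by exists BTrue.
  by exists BFalse.
have t0 : 0 < t by lia.
case: (leqP t 4) => t4.
  rewrite muln_eq0 negb_or => /andP[/is_aexpP[e1 h1] /is_aexpP[e2 h2]].
  rewrite -(cpair_unpair r) -h1 -h2.
  case: t t1 t4 {t0 IH} => [|[|[|[|[|//]]]]] // _ _.
  - by exists (BLe e1 e2).
  - by exists (BLt e1 e2).
  - by exists (BEq e1 e2).
case: (t =P 5) => t5.
  rewrite past_arg // => /(IH _ (cpair_gt _ t0))[b <-].
  by rewrite t5; exists (BNot b).
case: (leqP t 7) => // t7.
have [x [y er]] := cpair_surj r; subst r; rewrite !(cfstK, csndK).
have [h1 h2] := cpair_arg x y t0.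
rewrite past_fst // past_snd //.
rewrite muln_eq0 negb_or => /andP[/(IH _ h1)[e1 <-] /(IH _ h2)[e2 <-]].
have [->|->] : t = 6 \/ t = 7 by lia.
- by exists (BAnd e1 e2).
- by exists (BOr e1 e2).
Qed.

Lemma is_progP n : (exists P, enc_prog P = n) <-> is_prog n != 0.
Proof.
have ha e : is_aexp (enc_aexp e) != 0 by apply/is_aexpP; exists e.
have hb e : is_bexp (enc_bexp e) != 0 by apply/is_bexpP; exists e.
have lt3 t x y z : 0 < t -> z < cpair t (cpair x (cpair y z)).
  by move=> /(cpair_gt (cpair x (cpair y z))); have := cpair_ge x (cpair y z);
    have := cpair_ge y z; lia.
split=> [[P <-{n}]|].
  rewrite /is_prog; elim: P => [|x e|P1 IH1 P2 IH2|P1 IH1 p P2 IH2|P1 IH1 P2 IH2|g P IH] /=;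
  rewrite /covrec /is_prog_body ?(cfstK, csndK) /= ?past_fst ?past_snd //;
  rewrite ?past_hist ?lt3 //;
  by rewrite ?muln_eq0 ?negb_or ?IH1 ?IH2 ?ha ?hb.
elim/ltn_ind: n => n; rewrite -(cpair_unpair n); move: (cfst n) (csnd n) => {n} t r IH.
rewrite /is_prog /covrec /is_prog_body !(cfstK, csndK).
have [t0|t0] := posnP t.
  by rewrite t0 eqb0 negbK => /eqP->; exists PBot.
case: (t =P 1) => [->|_].
  move=> /is_aexpP[e he]; exists (PAssign (cfst r) e).
  by rewrite /= he cpair_unpair.
have [x [y er]] := cpair_surj r; subst r; rewrite !(cfstK, csndK).
have [h1 h2] := cpair_arg x y t0.
rewrite past_fst // past_snd //.
case: (t =P 2) => [->|_].
  rewrite muln_eq0 negb_or => /andP[/(IH _ h1)[P1 <-] /(IH _ h2)[P2 <-]].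
  by exists (PSeq P1 P2).
case: (t =P 3) => [t3|_].
  have [u [v ey]] := cpair_surj y; subst y; rewrite !(cfstK, csndK).
  rewrite !muln_eq0 !negb_or => /and3P[/(IH _ h1)[P1 <-] /is_aexpP[p <-]].
  rewrite past_hist ?lt3 // => /(IH _ (lt3 _ _ _ _ t0))[P2 <-].
  by exists (PProb P1 p P2); rewrite t3.
case: (t =P 4) => [->|_].
  rewrite muln_eq0 negb_or => /andP[/(IH _ h1)[P1 <-] /(IH _ h2)[P2 <-]].
  by exists (PNondet P1 P2).
case: (t =P 5) => [->|//].
rewrite muln_eq0 negb_or => /andP[/is_bexpP[b <-] /(IH _ h2)[P <-]].
by exists (PWhile b P).
Qed.

(** Here [j] is the bound and the entry at [j.*2.+1] is the cutoff N. The two length tests ensure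
    that the prefix contains this entry and all scheduler values consulted: queried words are
    shorter than N, their codes are below 5^N, and they are looked up at twice the code. The
    condition [n != 0] removes [PBot]; searching [j] below [s] suffices since a code bounds its
    length. *)
Definition PAST_check (n s : nat) : bool :=
  [&& is_prog n != 0, n != 0 &
      has (fun j => (iter j.*2.+1 code_tail s != 0) &&
        (iter (2 * 5 ^ code_nth s j.*2.+1) code_tail s != 0) &&
        qle (code_runtime s (state_code n 0 (qnat 1) 0) (code_nth s j.*2.+1))
            (qnat j)) (iota 0 s)].

Lemma PAST_check_recursive : recursive_rel PAST_check.
Proof.
have [c hc] : lcomputable (fun l => nat_of_bool (PAST_check (nth 0 l 0) (nth 0 l 1))).
  apply: (lcomp_app2 (f := fun n s => nat_of_bool (PAST_check n s)))
    (lcomp_nth 0) (lcomp_nth 1).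
  apply: (lcomp_ext (F := fun l => let z := cpair (nth 0 l 0) (nth 0 l 1) in
    nat_of_bool (PAST_check (cfst z) (csnd z)))) => [l|]; first by rewrite /= cfstK csndK.
  apply: (lcomp_app1 (f := fun z => nat_of_bool (PAST_check (cfst z) (csnd z))))
    (lcomp_cpair (lcomp_nth 0) (lcomp_nth 1)).
  change (computableb (fun z => PAST_check (cfst z) (csnd z))).
  have hd := comp_double.
  by rewrite /PAST_check; auto 40 with computability nocore.
by exists c => n s; have := hc [:: n; s].
Qed.

Lemma represents_init P : represents (state_code (enc_prog P) 0 (qnat 1) 0)
  (init_estate (init_pstate P)).
Proof.
exists 0, (qnat 1), 0; split; first by [].
split; [exact: val_code0|exact: qval_nat|by []].
Qed.

Lemma PAST_Pi11 : Pi11 PAST_set.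
Proof.
exists PAST_check; split; first exact: PAST_check_recursive.
move=> n; have nth_prefix alpha m i : i < m -> code_nth (prefix_code alpha m) i = alpha i.
  by move=> lt_im; rewrite code_nthE nth_mkseq.
have queries w k N : size w < k -> k <= N -> 2 * word_code w < 2 * 5 ^ N.
  move=> hw kN; rewrite ltn_pmul2l //; apply: leq_trans (word_code_lt w) _.
  by rewrite leq_exp2l // (leq_trans (ltnW hw)).
split=> [[P [<- /PAST_runtime[nb hP]]] alpha|h].
  have [B hB] := hP (oracle_scheduler alpha).
  (* Long enough to include the cutoff entry and every even position consulted before that
     cutoff. *)
  pose N := alpha B.*2.+1; pose m := B.*2.+2 + (2 * 5 ^ N).+1; exists m.
  apply/and3P; split; [by apply/is_progP; exists P|by rewrite enc_prog_eq0|].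
  apply/hasP; exists B.
    rewrite mem_iota /= add0n; apply: leq_trans (size_seq_code _).
    by rewrite size_mkseq /m -addnn; lia.
  rewrite !code_drop_neq0 size_mkseq nth_prefix; last by rewrite /m; lia.
  rewrite -/N; apply/andP; split; first by apply/andP; split; rewrite /m; lia.
  rewrite -qval_le qval_nat (code_runtimeE _ _ (represents_init P)).
  rewrite (runtime_ext (g := oracle_scheduler alpha)) // => w /= hw.
  rewrite /oracle_scheduler nth_prefix //.
  by have := queries _ _ _ hw (leqnn N); rewrite /m; lia.
have [/is_progP[P hP] n0] : is_prog n != 0 /\ n != 0.
  (* The first two tests do not depend on the sequence, so any sequence will do. *)
  by have [m] := h id; case/and3P.
exists P; split=> //; apply/PAST_runtime; split; first by rewrite -enc_prog_eq0 hP.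
move=> f; apply: contrapT => /forallNP hf.
(* If no bound works for [f], each candidate [B] is exceeded at some cutoff. These cutoffs become
   the odd entries of the sequence that defeats the check. *)
have /choice[g hg] B : exists N,
    ~ (runtime f N (init_estate (init_pstate P)) <= B%:R)%R.
  by have /existsNP := hf B.
have [code_f hcf] : exists code_f : nat -> nat, forall w, (code_f (word_code w) == 0) = f w.
  (* The value 0 stands for the left choice; numbers that code no word get 1. *)
  exists (fun c => if pselect (exists2 w, word_code w = c & f w) is left _ then 0 else 1).
  move=> w; case: pselect => [[u /word_code_inj -> ->]//|hn].
  by case fw: (f w) => //; case: hn; exists w.
pose alpha i := if odd i then g i./2 else code_f i./2.
have hodd B : alpha B.*2.+1 = g B.
  by rewrite /alpha /= odd_double /= uphalf_double.
have [m] := h alpha; case/and3P => _ _ /hasP[B _].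
rewrite !code_drop_neq0 size_mkseq => /andP[/andP[h1]].
rewrite nth_prefix // hodd => h2.
rewrite -qval_le qval_nat -hP (code_runtimeE _ _ (represents_init P)).
rewrite (runtime_ext (g := f)) => [|w /= hw]; first exact: hg.
rewrite /oracle_scheduler nth_prefix; last first.
  by apply: ltn_trans h2; apply: queries hw _.
by rewrite /alpha mul2n odd_double doubleK.
Qed.

(** * Compilation of recursive functions *)

Local Open Scope ring_scope.

Lemma runtime0 f s : runtime f 0 s = 0.
Proof. by rewrite /runtime big_ord0. Qed.

Lemma runtimeS f N s : runtime f N.+1 s =
  if is_bot (es_prog s) then 0 else
  es_prob s + (runtime f N (successor f false s) + runtime f N (successor f true s)).
Proof.
rewrite /runtime big_ord_recl /=; case: ifP => sb.
  by rewrite add0r big1.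
by rewrite -big_split.
Qed.

Lemma runtime_prob0 f N s : es_prob s = 0 -> runtime f N s = 0.
Proof. by move=> s0; rewrite /runtime big1 // => k _; apply: alive_prob0. Qed.

Lemma runtime_ge0 f N s : 0 <= es_prob s -> 0 <= runtime f N s.
Proof. by move=> s0; apply: sumr_ge0 => k _; apply: alive_ge0. Qed.

Lemma runtime_mono f M N s : 0 <= es_prob s -> (M <= N)%N ->
  runtime f M s <= runtime f N s.
Proof.
move=> s0 /subnKC <-; elim: (N - M)%N => [|k IHk]; first by rewrite addn0.
apply: le_trans IHk _; rewrite addnS [leRHS]/runtime big_ord_recr /=.
by rewrite lerDl alive_ge0.
Qed.

(** Deterministic steps keep the mass, add no letter and look the same under every scheduler, so a
    compiled computation can be verified once and placed at any point of a run. *)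
Definition dstep (P : prog) (eta : valuation) (P' : prog) (eta' : valuation) : Prop :=
  ~~ is_bot P /\ forall f b a w,
    successor_from f b P eta a w = EState P' eta' (if b then 0 else a) w.

Lemma dstep_assign v e eta :
  dstep (PAssign v e) eta PBot (upd eta v (aeval eta e)).
Proof. by split. Qed.

Lemma dstep_bot Q eta : dstep (PSeq PBot Q) eta Q eta.
Proof. by split. Qed.

Lemma dstep_seq Q P eta P' eta' :
  dstep P eta P' eta' -> dstep (PSeq P Q) eta (PSeq P' Q) eta'.
Proof. by case=> nb h; split=> // f b a w; rewrite /= (negbTE nb) h. Qed.

Lemma dstep_while_true b P eta : beval eta b ->
  dstep (PWhile b P) eta (PSeq P (PWhile b P)) eta.
Proof. by move=> hb; split=> // f c a w; rewrite /= hb. Qed.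

Lemma dstep_while_false b P eta : ~~ beval eta b ->
  dstep (PWhile b P) eta PBot eta.
Proof. by move=> hb; split=> // f c a w; rewrite /= (negbTE hb). Qed.

Inductive dsteps : nat -> prog -> valuation -> prog -> valuation -> Prop :=
| dsteps0 P eta : dsteps 0 P eta P eta
| dstepsS n P eta P1 eta1 P2 eta2 :
    dstep P eta P1 eta1 -> dsteps n P1 eta1 P2 eta2 -> dsteps n.+1 P eta P2 eta2.

Lemma dsteps1 P eta P' eta' : dstep P eta P' eta' -> dsteps 1 P eta P' eta'.
Proof. by move=> h; apply: dstepsS h _; constructor. Qed.

Lemma dsteps_trans m n P eta P1 eta1 P2 eta2 :
  dsteps m P eta P1 eta1 -> dsteps n P1 eta1 P2 eta2 ->
  dsteps (m + n) P eta P2 eta2.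
Proof. by move=> h; elim: h n P2 eta2 => // m' *; rewrite addSn; apply: dstepsS; eauto. Qed.

Lemma dsteps_seq Q n P eta P' eta' :
  dsteps n P eta P' eta' -> dsteps n (PSeq P Q) eta (PSeq P' Q) eta'.
Proof.
elim=> [*|{}n {}P {}eta P1 eta1 P2 eta2 h _ IH]; first by constructor.
by apply: dstepsS IH; apply: dstep_seq.
Qed.

Definition dexec n P eta eta' := dsteps n P eta PBot eta'.

Lemma dexec_assign v e eta : dexec 1 (PAssign v e) eta (upd eta v (aeval eta e)).
Proof. exact/dsteps1/dstep_assign. Qed.

Lemma dsteps_seq_bot n P Q eta eta' :
  dexec n P eta eta' -> dsteps n.+1 (PSeq P Q) eta Q eta'.
Proof.
move=> h; rewrite -addn1; apply: dsteps_trans (dsteps_seq Q h) _.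
exact/dsteps1/dstep_bot.
Qed.

Lemma dexec_seq m n P Q eta eta1 eta2 :
  dexec m P eta eta1 -> dexec n Q eta1 eta2 -> dexec (m.+1 + n) (PSeq P Q) eta eta2.
Proof. by move=> /(dsteps_seq_bot Q) h1 h2; apply: dsteps_trans h1 h2. Qed.

Lemma dexec_while_false b P eta : ~~ beval eta b -> dexec 1 (PWhile b P) eta eta.
Proof. by move=> h; apply/dsteps1/dstep_while_false. Qed.

Lemma dexec_while_true m n b P eta eta1 eta2 : beval eta b ->
  dexec m P eta eta1 -> dexec n (PWhile b P) eta1 eta2 ->
  dexec (m.+1 + n).+1 (PWhile b P) eta eta2.
Proof.
move=> hb h1 h2; apply: dstepsS (dexec_seq h1 h2).
exact: dstep_while_true.
Qed.

Definition exec P eta eta' := exists n, dexec n P eta eta'.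

Lemma exec_bot eta : exec PBot eta eta.
Proof. by exists 0%N; constructor. Qed.

Lemma exec_assign v e eta : exec (PAssign v e) eta (upd eta v (aeval eta e)).
Proof. by exists 1%N; apply: dexec_assign. Qed.

Lemma exec_seq P Q eta eta1 eta2 :
  exec P eta eta1 -> exec Q eta1 eta2 -> exec (PSeq P Q) eta eta2.
Proof. by case=> m h1 [n h2]; exists (m.+1 + n)%N; apply: dexec_seq h1 h2. Qed.

Lemma exec_while_false b P eta : ~~ beval eta b -> exec (PWhile b P) eta eta.
Proof. by exists 1%N; apply: dexec_while_false. Qed.

Lemma exec_while_true b P eta eta1 eta2 : beval eta b ->
  exec P eta eta1 -> exec (PWhile b P) eta1 eta2 -> exec (PWhile b P) eta eta2.
Proof. by move=> hb [m h1] [n h2]; eexists; apply: dexec_while_true hb h1 h2. Qed.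

(** Truncated running times are compared with the cutoff shifted by [n]. The costs include side
    branches that never reach [s']; [lo] serves the divergence proof, [hi] the boundedness proof,
    and [0 < n] lets an induction on the cutoff advance. *)
Definition leads f (lo hi : rat) (s s' : estate) : Prop :=
  exists n, (0 < n)%N /\ forall N,
    lo + runtime f N s' <= runtime f (n + N) s <= hi + runtime f N s'.

Lemma leads_trans f lo1 hi1 lo2 hi2 s1 s2 s3 :
  leads f lo1 hi1 s1 s2 -> leads f lo2 hi2 s2 s3 ->
  leads f (lo1 + lo2) (hi1 + hi2) s1 s3.
Proof.
case=> m [m0 h1] [n [n0 h2]]; exists (m + n)%N; split; first by rewrite addn_gt0 m0.
move=> N; have /andP[h3 h4] := h1 (n + N)%N; have /andP[h5 h6] := h2 N.
by rewrite -addnA; lra.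
Qed.

Lemma leads_weaken f lo hi lo' hi' s s' : lo' <= lo -> hi <= hi' ->
  leads f lo hi s s' -> leads f lo' hi' s s'.
Proof.
move=> hlo hhi [n [n0 h]]; exists n; split=> // N.
by have /andP[h1 h2] := h N; lra.
Qed.

Lemma leads_dsteps f n P eta P' eta' a w : (0 < n)%N -> dsteps n P eta P' eta' ->
  leads f (n%:R * a) (n%:R * a) (EState P eta a w) (EState P' eta' a w).
Proof.
move=> n0 h; exists n; split=> // N.
suff -> : runtime f (n + N) (EState P eta a w) =
    n%:R * a + runtime f N (EState P' eta' a w) by rewrite lexx.
elim: h {n0} => [*|{}n {}P {}eta P1 eta1 P2 eta2 [nb h] _ IH].
  by rewrite mul0r add0r.
rewrite addSn runtimeS /= (negbTE nb) /successor /= !h.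
by rewrite [X in _ + (_ + X)]runtime_prob0 // addr0 IH -natr1; ring.
Qed.

Definition bounded_runtime f s := exists B : rat, forall N, runtime f N s <= B.

Lemma leads_bounded f lo hi s s' : leads f lo hi s s' -> 0 <= es_prob s ->
  bounded_runtime f s' -> bounded_runtime f s.
Proof.
move=> [n [_ h]] s0 [B hB]; exists (hi + B) => N.
apply: le_trans (runtime_mono f s0 (leq_addl n N)) _.
by have /andP[_ /le_trans] := h N; apply; rewrite lerD2l.
Qed.

Lemma dexec_bounded f n P eta eta' a w : 0 <= a -> dexec n P eta eta' ->
  forall N, runtime f N (EState P eta a w) <= n%:R * a.
Proof.
move=> a0 h N; have [n0|n0] := posnP n.
  by move: h; rewrite n0 mul0r => h; inversion h; case: N => [|N]; rewrite ?runtime0 ?runtimeS.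
have [m [_ hm]] := leads_dsteps f a w n0 h.
apply: le_trans (runtime_mono f (s := EState P eta a w) a0 (leq_addl m N)) _.
have /andP[_ /le_trans] := hm N; apply.
by case: N => [|N]; rewrite ?runtime0 ?runtimeS /= addr0.
Qed.

Lemma exec_bounded f P eta eta' a w : 0 <= a -> exec P eta eta' ->
  bounded_runtime f (EState P eta a w).
Proof. by move=> a0 [n h]; exists (n%:R * a) => N; apply: dexec_bounded h N. Qed.

(* [fr] is the first variable that the program may use as scratch space. *)
Fixpoint compile_args (cs : seq (seq var -> var -> var -> prog))
    (args : seq var) (dst fr : var) : prog :=
  if cs is c :: cs' then PSeq (c args dst fr) (compile_args cs' args dst.+1 fr)
  else PBot.

(** In [RPrec], [fr] counts, [fr.+1] holds the value so far and [fr.+2] receives the next one. In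
    [RMin], [fr] is the candidate and [fr.+1] the value there. A missing argument is compiled to 0,
    as in [reval]. *)
Fixpoint compile (c : recf) (args : seq var) (res fr : var) : prog :=
  match c with
  | RZero => PAssign res (AConst 0)
  | RSucc => PAssign res (AAdd (AVar (nth 0%N args 0)) (AConst 1))
  | RProj i =>
      PAssign res (if (i < size args)%N then AVar (nth 0%N args i) else AConst 0)
  | RComp f gs =>
      PSeq (compile_args (map compile gs) args fr (fr + size gs)%N)
           (compile f (iota fr (size gs)) res (fr + size gs)%N)
  | RPrec f g =>
      PSeq (compile f (behead args) fr.+1 fr.+3)
     (PSeq (PAssign fr (AConst 0))
     (PSeq (PWhile (BLt (AVar fr) (AVar (head 0%N args)))
             (PSeq (compile g (fr :: fr.+1 :: behead args) fr.+2 fr.+3)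
             (PSeq (PAssign fr.+1 (AVar fr.+2))
                   (PAssign fr (AAdd (AVar fr) (AConst 1))))))
           (PAssign res (AVar fr.+1))))
  | RMin f =>
      PSeq (PAssign fr (AConst 0))
     (PSeq (compile f (fr :: args) fr.+1 fr.+2)
     (PSeq (PWhile (BLt (AConst 0) (AVar fr.+1))
             (PSeq (PAssign fr (AAdd (AVar fr) (AConst 1)))
                   (compile f (fr :: args) fr.+1 fr.+2)))
           (PAssign res (AVar fr))))
  end.

Definition natvals (l : seq nat) : seq rat := [seq n%:R | n <- l].

Definition compile_correct (c : recf) : Prop :=
  forall args res fr eta l v, reval c l v ->
    all (fun x => x < fr)%N args -> (res < fr)%N -> map eta args = natvals l ->
    exists eta', [/\ exec (compile c args res fr) eta eta', eta' res = v%:R &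
      forall x, (x < fr)%N -> x != res -> eta' x = eta x].

(** The list inside [RComp] requires an induction hypothesis for each of its members. *)
Lemma recf_ind_list (P : recf -> Prop) :
  P RZero -> P RSucc -> (forall i, P (RProj i)) ->
  (forall f gs, P f -> List.Forall P gs -> P (RComp f gs)) ->
  (forall f g, P f -> P g -> P (RPrec f g)) ->
  (forall f, P f -> P (RMin f)) -> forall c, P c.
Proof.
move=> h0 hS hP hC hR hM; fix IH 1 => -[||i|f gs|f g|f].
- exact: h0.
- exact: hS.
- exact: hP.
- by apply: hC; [exact: IH|elim: gs => [|g gs IHgs]; constructor; [exact: IH|]].
- by apply: hR; exact: IH.
- by apply: hM; exact: IH.
Qed.

Lemma upd_same eta v q : upd eta v q v = q.
Proof. by rewrite /upd eqxx. Qed.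

Lemma upd_other eta v q x : x != v -> upd eta v q x = eta x.
Proof. by rewrite /upd => /negbTE->. Qed.

Lemma map_preserved (eta eta' : valuation) (s : seq var) fr : all (fun x => x < fr)%N s ->
  (forall x, (x < fr)%N -> eta' x = eta x) -> map eta' s = map eta s.
Proof. by move=> /allP hs h; apply/eq_in_map => x /hs /h. Qed.

Lemma all_lt_trans (s : seq var) m n : (m <= n)%N -> all (fun x => x < m)%N s ->
  all (fun x => x < n)%N s.
Proof. by move=> le_mn; apply: sub_all => x /leq_trans; apply. Qed.

Lemma compile_args_correct gs args dst fr eta l ms :
  List.Forall compile_correct gs ->
  List.Forall2 (fun g m => reval g l m) gs ms ->
  all (fun x => x < dst)%N args -> (dst + size gs <= fr)%N ->
  map eta args = natvals l ->
  exists eta', [/\ exec (compile_args (map compile gs) args dst fr) eta eta',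
    map eta' (iota dst (size gs)) = natvals ms &
    forall x, (x < dst)%N -> eta' x = eta x].
Proof.
elim: gs ms dst eta => [|g gs IHgs] ms dst eta hgs hms hargs hfr hl.
  by exists eta; inversion hms; split=> //; exact: exec_bot.
inversion hgs as [|? ? hg hgs']; inversion hms as [|? m ? ms' hm hms']; subst.
have [lt_fr lt_fr'] : (dst < fr)%N /\ (dst.+1 + size gs <= fr)%N.
  by move: hfr => /=; lia.
have [eta1 [ex1 v1 p1]] :=
  hg args dst fr eta l m hm (all_lt_trans (ltnW lt_fr) hargs) lt_fr hl.
have p1' x : (x < dst)%N -> eta1 x = eta x.
  by move=> hx; apply: p1; [apply: ltn_trans lt_fr|rewrite ltn_eqF].
have [eta2 [ex2 v2 p2]] := IHgs ms' dst.+1 eta1 hgs' hms'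
  (all_lt_trans (leqnSn _) hargs) lt_fr' (etrans (map_preserved hargs p1') hl).
exists eta2; split.
- exact: exec_seq ex1 ex2.
- by rewrite /= v2 p2 // v1.
- by move=> x hx; rewrite p2 ?p1' // ltnW.
Qed.

Lemma reval_RPrecS f g x l v : reval (RPrec f g) (x.+1 :: l) v ->
  exists r, reval (RPrec f g) (x :: l) r /\ reval g (x :: r :: l) v.
Proof. by move=> h; inversion h; subst; exists r. Qed.

Lemma compile_RPrec f g : compile_correct f -> compile_correct g ->
  compile_correct (RPrec f g).
Proof.
move=> hf hg args res fr eta l v hv hargs hres hl.
have [x [l' el]] : exists x l', l = x :: l' by inversion hv; subst; eauto.
subst l; case: args hargs hl => [//|y args] /andP[hy hargs] [ey hl].
have ltS x' : (x' < fr)%N -> (x' < fr.+3)%N by lia.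
rewrite [compile _ _ _ _]/=.
set W := PWhile _ _.
(* Loops unfold at the front, whereas the invariant grows at the back. It is therefore put in
   continuation form: any run of [W] from the valuation after [k] iterations extends to a run from
   the start. *)
have loop k u : (k <= x)%N -> reval (RPrec f g) (k :: l') u ->
  exists eta0 eta', [/\ exec (compile f args fr.+1 fr.+3) eta eta0,
    forall eta'', exec W eta' eta'' -> exec W (upd eta0 fr 0) eta'',
    eta' fr = k%:R, eta' fr.+1 = u%:R &
    forall z, (z < fr)%N -> eta' z = eta z].
  elim: k u => [|k IHk] u hk.
    move=> hu; have {}hu : reval f l' u by inversion hu.
    have [eta1 [ex1 v1 p1]] := hf args fr.+1 fr.+3 eta l' u hu
      (all_lt_trans (leq_addl 3 fr) hargs) (leqnSn _) hl.
    exists eta1, (upd eta1 fr 0); split=> //.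
    - by rewrite upd_same.
    - by rewrite upd_other // gtn_eqF.
    - by move=> z hz; rewrite upd_other ?ltn_eqF // p1 ?ltS // ltn_eqF // ltnW.
  move=> /reval_RPrecS[r [hr hu]].
  have [eta0 [eta1 [ex0 ex1 i1 r1 p1]]] := IHk r (ltnW hk) hr.
  have hl1 : map eta1 (fr :: fr.+1 :: args) = natvals (k :: r :: l').
    by rewrite /= i1 r1 (map_preserved hargs p1) hl.
  have hargs1 : all (fun z => z < fr.+3)%N (fr :: fr.+1 :: args).
    by rewrite /= (all_lt_trans (leq_addl 3 fr) hargs) !ltnS leqnSn (leq_addl 2 fr).
  have [eta2 [ex2 v2 p2]] := hg _ fr.+2 fr.+3 eta1 _ u hu hargs1 (leqnn _) hl1.
  exists eta0, (upd (upd eta2 fr.+1 (eta2 fr.+2)) fr (eta2 fr + 1)); split=> //.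
  - move=> eta'' ex3; apply: ex1; apply: exec_while_true ex3.
      by rewrite /= i1 p1 // ey ltr_nat.
    apply: exec_seq ex2 _; apply: exec_seq (exec_assign _ _ _) _.
    have := exec_assign fr (AAdd (AVar fr) (AConst 1)) (upd eta2 fr.+1 (eta2 fr.+2)).
    by rewrite /= upd_other // ltn_eqF.
  - by rewrite upd_same p2 ?i1 ?natr1 ?ltn_eqF // (leq_addl 2 fr.+1).
  - by rewrite upd_other ?gtn_eqF // upd_same.
  - move=> z hz; rewrite !upd_other ?ltn_eqF ?p2 ?p1 ?ltS // ?ltn_eqF //; lia.
have [eta0 [eta1 [ex0 ex1 i1 r1 p1]]] := loop x v (leqnn _) hv.
exists (upd eta1 res (eta1 fr.+1)); split.
- apply: exec_seq ex0 _; apply: exec_seq (exec_assign _ _ _) _.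
  apply: exec_seq (exec_assign res (AVar fr.+1) eta1).
  by apply: ex1; apply: exec_while_false; rewrite /= i1 p1 // ey ltxx.
- by rewrite upd_same.
- by move=> z hz nz; rewrite upd_other // p1.
Qed.

Lemma compile_RMin f : compile_correct f -> compile_correct (RMin f).
Proof.
move=> hf args res fr eta l v hv hargs hres hl.
have [hv0 hvS] : reval f (v :: l) 0 /\
    forall m, (m < v)%N -> exists k, reval f (m :: l) k.+1 by inversion hv.
have hargs' : all (fun z => z < fr.+2)%N (fr :: args).
  by rewrite /= (all_lt_trans (leq_addl 2 fr) hargs) ltnS leqnSn.
rewrite [compile _ _ _ _]/=.
set W := PWhile _ _.
have run k eta1 u : reval f (k :: l) u -> eta1 fr = k%:R ->
    (forall z, (z < fr)%N -> eta1 z = eta z) ->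
    exists eta2, [/\ exec (compile f (fr :: args) fr.+1 fr.+2) eta1 eta2,
      eta2 fr = k%:R, eta2 fr.+1 = u%:R &
      forall z, (z < fr)%N -> eta2 z = eta z].
  move=> hu i1 p1.
  have hl1 : map eta1 (fr :: args) = natvals (k :: l).
    by rewrite /= i1 (map_preserved hargs p1) hl.
  have [eta2 [ex2 v2 p2]] := hf _ fr.+1 fr.+2 eta1 _ u hu hargs' (leqnn _) hl1.
  exists eta2; split=> //; first by rewrite p2 ?ltn_eqF // ltnW.
  by move=> z hz; rewrite p2 ?p1 ?ltn_eqF //; lia.
have loop k u : (k <= v)%N -> reval f (k :: l) u ->
  exists eta0 eta', [/\
    exec (compile f (fr :: args) fr.+1 fr.+2) (upd eta fr 0) eta0,
    forall eta'', exec W eta' eta'' -> exec W eta0 eta'',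
    eta' fr = k%:R, eta' fr.+1 = u%:R &
    forall z, (z < fr)%N -> eta' z = eta z].
  elim: k u => [|k IHk] u hk hu.
    have [|z hz|eta1 [ex1 i1 r1 p1]] := run 0%N (upd eta fr 0) u hu.
    - by rewrite upd_same.
    - by rewrite upd_other // ltn_eqF.
    by exists eta1, eta1; split.
  have [m hm] := hvS k hk.
  have [eta0 [eta1 [ex0 ex1 i1 r1 p1]]] := IHk _ (ltnW hk) hm.
  have [|z hz|eta2 [ex2 i2 r2 p2]] := run k.+1 (upd eta1 fr (eta1 fr + 1)) u hu.
  - by rewrite upd_same i1 natr1.
  - by rewrite upd_other ?ltn_eqF // p1.
  exists eta0, eta2; split=> // eta'' ex3; apply: ex1; apply: exec_while_true ex3.
    by rewrite /= r1 ltr0n.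
  exact: exec_seq (exec_assign fr (AAdd (AVar fr) (AConst 1)) eta1) ex2.
have [eta0 [eta1 [ex0 ex1 i1 r1 p1]]] := loop v 0%N (leqnn _) hv0.
exists (upd eta1 res (eta1 fr)); split.
- apply: exec_seq (exec_assign _ _ _) _; apply: exec_seq ex0 _.
  apply: exec_seq (exec_assign res (AVar fr) eta1).
  by apply: ex1; apply: exec_while_false; rewrite /= r1 ltxx.
- by rewrite upd_same.
- by move=> z hz nz; rewrite upd_other // p1.
Qed.

Lemma compileP c : compile_correct c.
Proof.
elim/recf_ind_list: c => [||i|f gs hf hgs||].
- move=> args res fr eta l v hv _ _ _; have -> : v = 0%N by inversion hv.
  exists (upd eta res 0); split; [exact: exec_assign|exact: upd_same|].
  by move=> x _; apply: upd_other.
- move=> args res fr eta l v hv _ _ hl.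
  exists (upd eta res v%:R); split; [|exact: upd_same|].
    inversion hv; subst; case: args hl => [//|y args] [ey _].
    have := exec_assign res (AAdd (AVar y) (AConst 1)) eta.
    by rewrite /= ey natr1.
  by move=> x _; apply: upd_other.
- move=> args res fr eta l v hv _ _ hl.
  exists (upd eta res v%:R); split; [|exact: upd_same|].
    have -> : v = nth 0%N l i by inversion hv.
    rewrite /=; set e := if _ then _ else _.
    have -> : (nth 0%N l i)%:R = aeval eta e; last exact: exec_assign.
    have sz : size args = size l by rewrite -(size_map eta) hl size_map.
    rewrite /e; case: ifP => hi /=.
      by rewrite -(nth_map 0%N 0 eta) // hl (nth_map 0%N) // -sz.
    by rewrite nth_default // -sz leqNgt hi.
  by move=> x _; apply: upd_other.
- move=> args res fr eta l v hv hargs hres hl.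
  have [ms [hms hv']] : exists ms, List.Forall2 (fun g m => reval g l m) gs ms /\
    reval f ms v by inversion hv; subst; eauto.
  have [eta1 [ex1 v1 p1]] := compile_args_correct hgs hms hargs (leqnn _) hl.
  have hiota : all (fun x => x < fr + size gs)%N (iota fr (size gs)).
    by apply/allP => x; rewrite mem_iota => /andP[].
  have [eta2 [ex2 v2 p2]] := hf _ res _ eta1 _ _ hv' hiota (ltn_addr _ hres) v1.
  exists eta2; split=> //; first exact: exec_seq ex1 ex2.
  by move=> x hx nx; rewrite p2 ?p1 // ltn_addr.
- exact: compile_RPrec.
- exact: compile_RMin.
Qed.

Local Close Scope ring_scope.

(** * Hardness *)

Lemma enc_int_inj : injective enc_int.
Proof.
case=> m [] n /=.
- by move/double_inj->.
- by move/(congr1 odd); rewrite /= !odd_double.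
- by move/(congr1 odd); rewrite /= !odd_double.
- by case=> /double_inj->.
Qed.

Lemma enc_rat_inj : injective enc_rat.
Proof.
move=> p q /cpair_inj[/enc_int_inj en /enc_int_inj ed].
by rewrite -(divq_num_den p) en ed divq_num_den.
Qed.

Lemma enc_aexp_inj : injective enc_aexp.
Proof.
by elim=> [q|x|e1 IH1 e2 IH2|e1 IH1 e2 IH2|e1 IH1 e2 IH2]
  [q'|x'|e1' e2'|e1' e2'|e1' e2'] /= /cpair_inj[] // _;
  try move=> /cpair_inj[/IH1-> /IH2->] //; [move=> /enc_rat_inj->|move=> ->].
Qed.

Lemma enc_bexp_inj : injective enc_bexp.
Proof.
by elim=> [||e1 e2|e1 e2|e1 e2|b IH|b1 IH1 b2 IH2|b1 IH1 b2 IH2]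
  [||e1' e2'|e1' e2'|e1' e2'|b'|b1' b2'|b1' b2'] //= /cpair_inj[] // _;
  try move=> /cpair_inj[/enc_aexp_inj-> /enc_aexp_inj->] //;
  try move=> /cpair_inj[/IH1-> /IH2->] //; move=> /IH->.
Qed.

(** [PAST_set] only supplies some program with the given code; this identifies it with the one built
    by the reduction. *)
Lemma enc_prog_inj : injective enc_prog.
Proof.
elim=> [|x e|P1 IH1 P2 IH2|P1 IH1 p P2 IH2|P1 IH1 P2 IH2|b P IH]
  [|x' e'|P1' P2'|P1' p' P2'|P1' P2'|b' P'] //= /cpair_inj[] // _ /cpair_inj[].
- by move=> -> /enc_aexp_inj->.
- by move=> /IH1-> /IH2->.
- by move=> /IH1-> /cpair_inj[/enc_aexp_inj-> /IH2->].
- by move=> /IH1-> /IH2->.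
- by move=> /enc_bexp_inj-> /IH->.
Qed.

(** Prepending to a sequence code is one arithmetic expression, appending is not. The hardness
    program hence keeps its prefix reversed, and the test reverses it back. The pair holds
    accumulator and rest; iterations beyond the length change nothing. *)
Definition rev_step (z : nat) : nat :=
  if csnd z == 0 then z
  else cpair (cpair (cfst (csnd z).-1) (cfst z)).+1 (code_tail (csnd z)).
Definition rev_code (s : nat) : nat := cfst (iter s rev_step (cpair 0 s)).

Lemma rev_codeE l : rev_code (seq_code l) = seq_code (rev l).
Proof.
rewrite /rev_code.
suff h m acc : size l <= m ->
    iter m rev_step (cpair (seq_code acc) (seq_code l)) =
    cpair (seq_code (catrev l acc)) 0.
  by rewrite (h _ [::]) ?size_seq_code // cfstK.
elim: l m acc => [|x l IHl] m acc.
  by move=> _; elim: m => //= m ->; rewrite /rev_step csndK.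
case: m => // m; rewrite ltnS => hm; rewrite iterSr /rev_step csndK /=.
by rewrite /code_tail /= !(cfstK, csndK) -[(cpair x _).+1]/(seq_code (x :: acc)) IHl.
Qed.

Lemma comp_rev_code A : computable A -> computable (fun x => rev_code (A x)).
Proof.
apply: comp_comp; rewrite /rev_code; apply: comp_cfst.
by apply: (comp_iter (G := fun r _ => rev_step r)); rewrite /rev_step;
  auto 20 with computability nocore.
Qed.

Local Open Scope ring_scope.

(** Expressions have no division, but over the rationals the halving in [cpair] is multiplication by
    the constant 1/2. *)
Definition pair_aexp (e1 e2 : aexp) : aexp :=
  AAdd (AMul (AMul (AAdd e1 e2) (AAdd (AAdd e1 e2) (AConst 1))) (AConst 2%:R^-1)) e2.

Lemma tri_rat n : (tri n)%:R = n%:R * (n%:R + 1) * 2%:R^-1 :> rat.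
Proof.
elim: n => [|n IHn]; first by rewrite !mul0r.
by rewrite triS natrD IHn -natr1; field.
Qed.

Lemma pair_aexpE eta e1 e2 m n : aeval eta e1 = m%:R -> aeval eta e2 = n%:R ->
  aeval eta (pair_aexp e1 e2) = (cpair m n)%:R.
Proof. by move=> h1 h2; rewrite /= h1 h2 cpairE natrD tri_rat natrD. Qed.

(* [v_verdict] receives the result of the compiled test on the input and the
   code of the reversed prefix, [v_go] is the flag of the choice loop, [v_entry]
   the entry being chosen, [v_time] the inverse of the surviving probability (0
   once the run is stopped) and [v_count] the countdown of the waiting loop. *)
Notation v_input := 0%N (only parsing).
Notation v_prefix := 1%N (only parsing).
Notation v_verdict := 2%N (only parsing).
Notation v_go := 3%N (only parsing).
Notation v_entry := 4%N (only parsing).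
Notation v_time := 5%N (only parsing).
Notation v_count := 6%N (only parsing).

Definition drop_out : prog := PSeq (PAssign v_time (AConst 0)) (PAssign v_go (AConst 0)).
Definition choose_bit : prog :=
  PNondet (PAssign v_go (AConst 0)) (PAssign v_entry (AAdd (AVar v_entry) (AConst 1))).
(** The fair coin halves the mass and the assignment doubles [v_time], so their product stays 1 on
    the surviving path. *)
Definition choose_round : prog :=
  PProb drop_out (AConst 2%:R^-1)
    (PSeq (PAssign v_time (AMul (AConst 2) (AVar v_time))) choose_bit).
Definition choose_loop : prog := PWhile (BEq (AVar v_go) (AConst 1)) choose_round.
Definition wait_loop : prog :=
  PWhile (BLt (AConst 0) (AVar v_count)) (PAssign v_count (ASub (AVar v_count) (AConst 1))).
Definition wait_push : prog :=
  PSeq (PAssign v_count (AVar v_time))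
    (PSeq wait_loop (PAssign v_prefix
      (AAdd (pair_aexp (AVar v_entry) (AVar v_prefix)) (AConst 1)))).
Definition extend : prog :=
  PSeq (PSeq (PAssign v_entry (AConst 0)) (PAssign v_go (AConst 1)))
    (PSeq choose_loop wait_push).
(** The grammar has no conditional; a probabilistic choice whose probability is the verdict 0 or 1
    takes its place. Verdict 1 ends the main loop by clearing [v_time]. *)
Definition loop_body (c : recf) : prog :=
  PSeq (compile c [:: v_input; v_prefix] v_verdict 7%N)
    (PProb (PAssign v_time (AConst 0)) (AVar v_verdict) extend).
Definition main_loop (c : recf) : prog :=
  PWhile (BLt (AConst 0) (AVar v_time)) (loop_body c).
Definition branch_prog (c : recf) (n : nat) : prog :=
  PSeq (PAssign v_input (AConst n%:R))
    (PSeq (PAssign v_time (AConst 1)) (main_loop c)).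

(** * Cost of the segments of a run *)

Definition holds_prefix (n : nat) (L : seq nat) (k : nat) (eta : valuation) : Prop :=
  [/\ eta v_input = n%:R, eta v_prefix = (seq_code (rev L))%:R &
      eta v_time = (2 ^ k)%:R].

Definition in_choice (n : nat) (L : seq nat) (i k : nat) (eta : valuation) : Prop :=
  [/\ holds_prefix n L k eta, eta v_go = 1 & eta v_entry = i%:R].

Definition choice_prog (c : recf) : prog := PSeq (PSeq choose_loop wait_push) (main_loop c).

Lemma leads_prob0 f P1 p P2 Q eta a w : aeval eta p = 0 ->
  leads f a a (EState (PSeq (PProb P1 p P2) Q) eta a w)
    (EState (PSeq P2 Q) eta a (w ++ [:: Rp])).
Proof.
move=> hp; exists 1%N; split=> // N; rewrite add1n runtimeS /= /successor /= hp.
have -> : clamp 0 = 0 by rewrite /clamp lexx.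
rewrite mulr0 [X in _ + (X + _)]runtime_prob0 // add0r subr0 mulr1.
by rewrite /seq_after /= lexx.
Qed.

Lemma leads_prob1 f P1 p P2 Q eta a w : aeval eta p = 1 ->
  leads f a a (EState (PSeq (PProb P1 p P2) Q) eta a w)
    (EState (PSeq P1 Q) eta a (w ++ [:: Lp])).
Proof.
move=> hp; exists 1%N; split=> // N; rewrite add1n runtimeS /= /successor /= hp.
have -> : clamp 1 = 1 by [].
rewrite subrr mulr0 [X in _ + (_ + X)]runtime_prob0 // addr0 mulr1.
by rewrite /seq_after /= lexx.
Qed.

(* After dropping out, t = 0 makes the remaining loops exit in a number of
   steps that does not depend on the valuation. *)
Lemma drop_out_dexec c : exists n, forall eta, exists eta',
  dexec n (PSeq (PSeq (PSeq drop_out choose_loop) wait_push) (main_loop c)) eta eta'.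
Proof.
eexists => eta; eexists.
apply: dexec_seq.
  apply: dexec_seq.
    apply: dexec_seq; first by apply: dexec_seq; exact: dexec_assign.
    exact: dexec_while_false.
  apply: dexec_seq; first exact: dexec_assign.
  apply: dexec_seq; last exact: dexec_assign.
  by apply: dexec_while_false; rewrite /= /upd /= ?ltxx.
by apply: dexec_while_false; rewrite /= /upd /= ?ltxx.
Qed.

Definition bit_prog (c : recf) (P : prog) : prog :=
  PSeq (PSeq (PSeq P choose_loop) wait_push) (main_loop c).

Lemma choose_fork c : exists2 C : rat, 0 <= C & forall f eta a w, 0 <= a -> eta v_go = 1 ->
  leads f 0 (C * a) (EState (choice_prog c) eta a w)
    (EState (bit_prog c choose_bit) (upd eta v_time (2 * eta v_time)) (a / 2%:R) (w ++ [:: Rp])).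
Proof.
have [n0 hn0] := drop_out_dexec c.
(* The dropped half costs at most [n0] steps of mass [a / 2]; the four steps on the surviving path
   have mass at most [a]. The constant depends on neither valuation nor scheduler. *)
exists (n0%:R + 5%:R) => [|f eta a w a0 h3]; first by rewrite addr_ge0 ?ler0n.
have a20 : 0 <= a / 2%:R by rewrite divr_ge0.
have h1 : dsteps 1 (choice_prog c) eta (bit_prog c choose_round) eta.
  by do 2 apply: dsteps_seq; apply/dsteps1/dstep_while_true; rewrite /= h3.
have h2 : leads f a (a + n0%:R * (a / 2%:R)) (EState (bit_prog c choose_round) eta a w)
    (EState (bit_prog c (PSeq (PAssign v_time (AMul (AConst 2) (AVar v_time))) choose_bit))
      eta (a / 2%:R) (w ++ [:: Rp])).
  exists 1%N; split=> // N; rewrite add1n runtimeS /= /successor /= /seq_after /=.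
  have -> : clamp 2%:R^-1 = 2%:R^-1 by [].
  have -> : a * (1 - 2%:R^-1) = a / 2%:R by congr (_ * _).
  have [eta' hd] := hn0 eta.
  have := dexec_bounded f (w ++ [:: Lp]) a20 hd N.
  have := runtime_ge0 f N (s := EState (PSeq (PSeq (PSeq drop_out choose_loop) wait_push)
    (main_loop c)) eta (a / 2%:R) (w ++ [:: Lp])) a20.
  rewrite /bit_prog.
  by move: (runtime f N _) (runtime f N _) => x y; lra.
have h3' : dsteps 2 (bit_prog c (PSeq (PAssign v_time (AMul (AConst 2) (AVar v_time))) choose_bit))
    eta (bit_prog c choose_bit) (upd eta v_time (2 * eta v_time)).
  by do 3 apply: dsteps_seq; apply/dsteps_seq_bot/dexec_assign.
have := leads_trans (leads_trans (leads_dsteps f a w (isT : 0 < 1)%N h1) h2)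
  (leads_dsteps f (a / 2%:R) (w ++ [:: Rp]) (isT : 0 < 2)%N h3').
apply: leads_weaken; first by lra.
have n0a : 0 <= n0%:R * a by rewrite mulr_ge0 ?ler0n.
by rewrite mulrA; lra.
Qed.

Lemma choose_bit_leads c f eta a w :
  leads f a a (EState (bit_prog c choose_bit) eta a w)
    (if f w then EState (bit_prog c (PAssign v_go (AConst 0))) eta a (w ++ [:: Ln])
     else EState (bit_prog c (PAssign v_entry (AAdd (AVar v_entry) (AConst 1)))) eta a
       (w ++ [:: Rn])).
Proof.
exists 1%N; split=> // N; rewrite add1n runtimeS /= /successor /= /seq_after /=.
case: (f w) => /=;
  by rewrite [X in _ + (_ + X)]runtime_prob0 // addr0 lexx.
Qed.

Lemma choose_round_leads c : exists2 C : rat, 0 <= C &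
  forall f n L i k eta w, in_choice n L i k eta ->
  let s := EState (choice_prog c) eta (2 ^ k)%:R^-1 w in
  if f (w ++ [:: Rp]) then
    exists eta', [/\ holds_prefix n L k.+1 eta', eta' v_go = 0, eta' v_entry = i%:R &
      leads f 0 (C * (2 ^ k)%:R^-1) s
        (EState (choice_prog c) eta' (2 ^ k.+1)%:R^-1 (w ++ [:: Rp] ++ [:: Ln]))]
  else
    exists eta', in_choice n L i.+1 k.+1 eta' /\
      leads f 0 (C * (2 ^ k)%:R^-1) s
        (EState (choice_prog c) eta' (2 ^ k.+1)%:R^-1 (w ++ [:: Rp] ++ [:: Rn])).
Proof.
(* The nondeterministic step and the two after it have mass [a / 2] each, which [2 * a] covers. *)
have [C C0 hC] := choose_fork c; exists (C + 2%:R); first by rewrite addr_ge0.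
move=> f n L i k eta w [[h0 h1 h5] h3 h4] s; rewrite !catA.
set a := (2 ^ k)%:R^-1 in s *; have a0 : 0 <= a by rewrite invr_ge0 ler0n.
have -> : (2 ^ k.+1)%:R^-1 = a / 2%:R by rewrite expnSr natrM invfM mulrC.
have e5 : 2 * eta v_time = (2 ^ k.+1)%:R by rewrite h5 expnS natrM.
have bit v e : dsteps 2 (bit_prog c (PAssign v e)) (upd eta v_time (2 * eta v_time))
    (choice_prog c) (upd (upd eta v_time (2 * eta v_time)) v
      (aeval (upd eta v_time (2 * eta v_time)) e)).
  by do 2 apply: dsteps_seq; apply/dsteps_seq_bot/dexec_assign.
have := choose_bit_leads c f (upd eta v_time (2 * eta v_time)) (a / 2%:R) (w ++ [:: Rp]).
move/(leads_trans (hC f eta a w a0 h3)).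
case: (f _) => hl.
  eexists; split; last first.
  - have := leads_trans hl (leads_dsteps f _ _ (isT : 0 < 2)%N (bit v_go (AConst 0))).
    by apply: leads_weaken; lra.
  - by rewrite /upd /= h4.
  - by [].
  - by split; rewrite /upd /= ?e5.
eexists; split; last first.
  have := leads_trans hl (leads_dsteps f _ _ (isT : 0 < 2)%N
    (bit v_entry (AAdd (AVar v_entry) (AConst 1)))).
  by apply: leads_weaken; lra.
by split; [split|..]; rewrite /upd /= ?e5 // h4 -natr1.
Qed.

Lemma wait_dexec m eta : eta v_count = m%:R -> exists n eta',
  [/\ (m <= n)%N, dexec n wait_loop eta eta' & forall x, x != v_count -> eta' x = eta x].
Proof.
elim: m eta => [|m IHm] eta h6.
  exists 1%N, eta; split=> //; apply: dexec_while_false.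
  by rewrite /= h6 ltxx.
have [|n [eta' [mn hn p]]] := IHm (upd eta v_count (eta v_count - 1)).
  by rewrite upd_same h6 -natr1 addrK.
exists (2 + n).+1%N, eta'; split; first by rewrite !ltnS (leq_trans mn) // leq_addl.
  apply: dexec_while_true hn; first by rewrite /= h6 ltr0n.
  exact: dexec_assign.
by move=> x hx; rewrite p // upd_other.
Qed.

(** The lower cost 1 comes from the waiting loop: at least 2^k steps at mass 2^-k. The upper cost is
    left unspecified because finiteness is all that is used. *)
Lemma choice_exit f c n L i k eta w : holds_prefix n L k eta ->
  eta v_go = 0 -> eta v_entry = i%:R ->
  exists eta' hi, holds_prefix n (rcons L i) k eta' /\
    leads f 1 hi (EState (choice_prog c) eta (2 ^ k)%:R^-1 w)
      (EState (main_loop c) eta' (2 ^ k)%:R^-1 w).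
Proof.
move=> [h0 h1 h5] h3 h4.
have [|m [eta1 [km hm p]]] := @wait_dexec (2 ^ k)%N (upd eta v_count (eta v_time)).
  by rewrite upd_same.
pose e := AAdd (pair_aexp (AVar v_entry) (AVar v_prefix)) (AConst 1).
have hx : dexec (2 + (2 + (m.+1 + 1))) (PSeq choose_loop wait_push) eta
    (upd eta1 v_prefix (aeval eta1 e)).
  apply: dexec_seq; first by apply: dexec_while_false; rewrite /= h3.
  apply: dexec_seq; first exact: dexec_assign.
  apply: dexec_seq hm _; exact: dexec_assign.
have := leads_dsteps f (2 ^ k)%:R^-1 w _ (dsteps_seq_bot (main_loop c) hx).
move/(_ isT) => hl; exists (upd eta1 v_prefix (aeval eta1 e)); eexists; split; last first.
  apply: leads_weaken hl => //.
  have e1 : (2 ^ k)%:R / (2 ^ k)%:R = 1 :> rat by rewrite mulfV ?pnatr_eq0 ?expn_eq0.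
  rewrite -[X in X <= _]e1.
  by apply: ler_wpM2r; rewrite ?invr_ge0 ?ler0n // ler_nat; lia.
split.
- by rewrite upd_other // p // upd_other.
- rewrite upd_same /e -[aeval _ _]/(aeval eta1 (pair_aexp (AVar v_entry) (AVar v_prefix)) + 1).
  rewrite (@pair_aexpE _ _ _ i (seq_code (rev L))) /= ?p ?upd_other //.
  by rewrite rev_rcons /= natr1.
- by rewrite upd_other // p // upd_other.
Qed.

Lemma main_loop_test c f n L k eta a w b : holds_prefix n L k eta ->
  reval c [:: n; seq_code (rev L)] b ->
  exists eta' hi, [/\ holds_prefix n L k eta', eta' v_verdict = b%:R &
    0 <= a -> leads f 0 hi (EState (main_loop c) eta a w)
      (EState (PSeq (PProb (PAssign v_time (AConst 0)) (AVar v_verdict) extend) (main_loop c))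
        eta' a w)].
Proof.
move=> [h0 h1 h5] hb.
have [|eta' [[m ex] h2 p]] := compileP (args := [:: v_input; v_prefix]) (res := v_verdict)
  (fr := 7%N) (eta := eta) hb isT isT.
  by rewrite /= h0 h1.
have st : dsteps (1 + m.+1) (main_loop c) eta
    (PSeq (PProb (PAssign v_time (AConst 0)) (AVar v_verdict) extend) (main_loop c)) eta'.
  apply: dsteps_trans; last exact: dsteps_seq (dsteps_seq_bot _ ex).
  by apply/dsteps1/dstep_while_true; rewrite /= h5 ltr0n expn_gt0.
exists eta'; eexists; split=> //; first by split; rewrite p.
move=> a0; apply: leads_weaken (leads_dsteps f a w _ st) => //.
by rewrite mulr_ge0 ?ler0n.
Qed.

Lemma main_loop_continue c f n L k eta a w : 0 <= a -> holds_prefix n L k eta ->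
  reval c [:: n; seq_code (rev L)] 0 ->
  exists eta' hi, in_choice n L 0 k eta' /\
    leads f 0 hi (EState (main_loop c) eta a w)
      (EState (choice_prog c) eta' a (w ++ [:: Rp])).
Proof.
move=> a0 hp hb; have [eta1 [hi [[h0 h1 h5] h2 /(_ a0) hl]]] := main_loop_test f a w hp hb.
have hp2 := leads_prob0 f (PAssign v_time (AConst 0)) extend (main_loop c) a w
  (h2 : aeval eta1 (AVar v_verdict) = 0).
have st : dsteps 4 (PSeq extend (main_loop c)) eta1 (choice_prog c)
    (upd (upd eta1 v_entry 0) v_go 1).
  apply: dsteps_seq; apply: (@dsteps_seq_bot 3); apply: (@dexec_seq 1 1);
  exact: dexec_assign.
exists (upd (upd eta1 v_entry 0) v_go 1); eexists; split; first by [].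
have := leads_trans (leads_trans hl hp2)
  (leads_dsteps f a (w ++ [:: Rp]) (isT : 0 < 4)%N st).
by apply: leads_weaken (lexx _); lra.
Qed.

Lemma main_loop_stop c f n L k eta a w : 0 <= a -> holds_prefix n L k eta ->
  reval c [:: n; seq_code (rev L)] 1 ->
  bounded_runtime f (EState (main_loop c) eta a w).
Proof.
move=> a0 hp hb; have [eta1 [hi [_ h2 /(_ a0) hl]]] := main_loop_test f a w hp hb.
apply: (leads_bounded hl) => //.
apply: (leads_bounded (leads_prob1 f _ _ _ _ _
  (h2 : aeval eta1 (AVar v_verdict) = 1))) => //.
apply: exec_bounded a0 _; apply: exec_seq (exec_assign _ _ _) _.
by apply: exec_while_false; rewrite /= /upd /= ?ltxx.
Qed.

Lemma init_leads f c n : exists eta hi, holds_prefix n [::] 0 eta /\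
  leads f 0 hi (init_estate (init_pstate (branch_prog c n)))
    (EState (main_loop c) eta 1 [::]).
Proof.
have st : dsteps (2 + 2) (branch_prog c n) eta0 (main_loop c)
    (upd (upd eta0 v_input n%:R) v_time 1).
  by apply: dsteps_trans; apply/dsteps_seq_bot/dexec_assign.
exists (upd (upd eta0 v_input n%:R) v_time 1); eexists; split; last first.
  by apply: leads_weaken (lexx _) (leads_dsteps f 1 [::] _ st).
by [].
Qed.

(** Unbounded time belongs to the invariant: it rules out stopping and forces another entry.
    Exponent and state are carried along so that a choice function can iterate it. *)
Definition at_head f c n (x : seq nat * nat * estate) : Prop :=
  (exists eta w, x.2 = EState (main_loop c) eta (2 ^ x.1.2)%:R^-1 w /\
    holds_prefix n x.1.1 x.1.2 eta) /\ ~ bounded_runtime f x.2.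

(* If the scheduler never leaves the choice loop, the surviving probability
   halves at every round of bounded length, so the running time is finite. *)
Lemma choice_leaves f c n L i k eta w : in_choice n L i k eta ->
  ~ bounded_runtime f (EState (choice_prog c) eta (2 ^ k)%:R^-1 w) ->
  exists i' x, x.1.1 = rcons L i' /\ at_head f c n x.
Proof.
move=> hin nb; apply: contrapT => no; apply: (nb).
have [C C0 hC] := choose_round_leads c.
(* This is the sum of the geometric series of round costs, and it reproduces itself: C 2^-k + 2C
   2^-(k+1) = 2C 2^-k. *)
exists (2%:R * C * (2 ^ k)%:R^-1) => N.
(* Either the scheduler leaves the loop before the cutoff, and then [no] makes the time after the
   exit bounded, or the series bound holds up to [N]. *)
suff h : forall N i k eta w, in_choice n L i k eta ->
    bounded_runtime f (EState (choice_prog c) eta (2 ^ k)%:R^-1 w) \/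
    runtime f N (EState (choice_prog c) eta (2 ^ k)%:R^-1 w) <= 2%:R * C * (2 ^ k)%:R^-1.
  by have [|] := h N i k eta w hin.
clear N i k eta w hin nb; elim=> [|N IHN] i k eta w hin.
  by right; rewrite runtime0 !mulr_ge0 ?invr_ge0 ?ler0n.
have a0 j : 0 <= (2 ^ j)%:R^-1 :> rat by rewrite invr_ge0 ler0n.
have /= := hC f n L i k eta w hin; case: (f _) => -[eta' h'].
  case: h' => hp h3 h4 hl; left; apply: (leads_bounded hl) => /=; first exact: a0.
  have [eta2 [hi [hp2 hl2]]] :=
    choice_exit f c (w ++ [:: Rp] ++ [:: Ln]) hp h3 h4.
  apply: (leads_bounded hl2) => /=; first exact: a0.
  apply: contrapT => nb; apply: no.
  by exists i, (rcons L i, k.+1, EState (main_loop c) eta2 (2 ^ k.+1)%:R^-1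
    (w ++ [:: Rp] ++ [:: Ln])); split=> //; split=> //; eexists; eexists.
case: h' => hin' hl; case: (IHN _ _ _ (w ++ [:: Rp] ++ [:: Rn]) hin') => hN.
  by left; exact: (leads_bounded hl (a0 _) hN).
right; case: hl => m [m0 /(_ N)/andP[_ hm]].
apply: le_trans (runtime_mono f (N := (m + N)%N) _ _) _.
- exact: a0.
- by rewrite -[X in (X < _)%N]add0n ltn_add2r.
apply: le_trans hm _; apply: le_trans (lerD (lexx _) hN) _.
by rewrite expnS natrM invfM; lra.
Qed.

Lemma head_continues f c (test : nat -> seq nat -> bool) n x :
  (forall L, reval c [:: n; seq_code (rev L)] (test n L)) ->
  at_head f c n x -> ~~ test n x.1.1 /\
    exists i x', x'.1.1 = rcons x.1.1 i /\ at_head f c n x'.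
Proof.
case: x => [[L k] s] c_test [[eta [w [/= -> hp]]] nb].
have a0 : 0 <= (2 ^ k)%:R^-1 :> rat by rewrite invr_ge0 ler0n.
have := c_test L; case: (test n L) => hb.
  by case: nb; exact: (main_loop_stop f w a0 hp hb).
split=> //; have [eta' [hi [hin hl]]] := main_loop_continue f w a0 hp hb.
by apply: (choice_leaves (w := w ++ [:: Rp]) hin) => h; apply: nb; exact: (leads_bounded hl a0 h).
Qed.

(** Unbounded time would survive along ever longer prefixes, each failing the test; their limit
    contradicts the hypothesis on all sequences. *)
Lemma branch_prog_bounded f c (test : nat -> seq nat -> bool) n :
  (forall L, reval c [:: n; seq_code (rev L)] (test n L)) ->
  (forall alpha, exists m, test n (mkseq alpha m)) ->
  bounded_runtime f (init_estate (init_pstate (branch_prog c n))).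
Proof.
move=> c_test hn; apply: contrapT => nb.
have [eta [hi [hp hl]]] := init_leads f c n.
pose x0 : seq nat * nat * estate := ([::], 0%N, EState (main_loop c) eta 1 [::]).
have hx0 : at_head f c n x0.
  split; last by move=> h; apply: nb; exact: (leads_bounded hl ler01 h).
  by exists eta, [::]; rewrite /= expn0 invr1.
(* Outside the invariant an arbitrary value is returned, making the relation total. *)
have /choice[next hnext] : forall x, exists y : nat * (seq nat * nat * estate),
    at_head f c n x -> y.2.1.1 = rcons x.1.1 y.1 /\ at_head f c n y.2.
  move=> x; have [hx|nx] := pselect (at_head f c n x); last by exists (0%N, x).
  by have [_ [i [x' h]]] := head_continues c_test hx; exists (i, x').
pose X m := iter m (fun x => (next x).2) x0.
pose alpha m := (next (X m)).1.
have hX m : at_head f c n (X m) /\ (X m).1.1 = mkseq alpha m.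
  elim: m => [|m [IH1 IH2]]; first by split.
  by have [e h] := hnext _ IH1; split=> //; rewrite mkseqS -IH2.
have [m] := hn alpha; have [h1 h2] := hX m.
by rewrite -h2; have [/negbTE->] := head_continues c_test h1.
Qed.

(* The number of completed entries and the value reached by the current one. *)
Definition word_progress (w : list letter) : nat * nat :=
  foldl (fun p x => match x with
    | Ln => (p.1.+1, 0%N) | Rn => (p.1, p.2.+1) | _ => p end) (0%N, 0%N) w.

Definition branch_scheduler (alpha : nat -> nat) : scheduler :=
  fun w => (word_progress w).2 == alpha (word_progress w).1.

Definition follows alpha c n m (s : estate) : Prop :=
  exists k eta w, [/\ s = EState (main_loop c) eta (2 ^ k)%:R^-1 w,
    holds_prefix n (mkseq alpha m) k eta & word_progress w = (m, 0%N)].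

(** Induction on the number [d] of increments still missing. The intermediate rounds are only given
    lower cost 0; the unit of cost is earned at the exit. *)
Lemma choice_follows alpha c n m i k eta w d : (i + d)%N = alpha m ->
  in_choice n (mkseq alpha m) i k eta -> word_progress w = (m, i) ->
  exists s' hi, follows alpha c n m.+1 s' /\
    leads (branch_scheduler alpha) 1 hi
      (EState (choice_prog c) eta (2 ^ k)%:R^-1 w) s'.
Proof.
have [C C0 hC] := choose_round_leads c.
have prog1 u x : word_progress (u ++ [:: Rp] ++ [:: x]) =
    match x with Ln => ((word_progress u).1.+1, 0%N)
    | Rn => ((word_progress u).1, (word_progress u).2.+1) | _ => word_progress u end.
  by rewrite /word_progress foldl_cat.
elim: d i k eta w => [|d IHd] i k eta w hd hin hw;
  have := hC (branch_scheduler alpha) _ _ _ _ _ w hin;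
  rewrite /branch_scheduler /word_progress foldl_cat -/(word_progress w) hw /= -hd.
  rewrite addn0 eqxx => -[eta1 [hp h3 h4 hl]].
  have [eta2 [hi [hp2 hl2]]] := choice_exit (branch_scheduler alpha) c
    (w ++ [:: Rp] ++ [:: Ln]) hp h3 h4.
  eexists; eexists; split; last first.
    by apply: leads_weaken (lexx _) (leads_trans hl hl2); rewrite add0r.
  exists k.+1, eta2, (w ++ [:: Rp] ++ [:: Ln]); split=> //; last by rewrite prog1 hw.
  by rewrite mkseqS -hd addn0.
rewrite -[X in X == _]addn0 eqn_add2l => -[eta1 [hin1 hl]].
have [||s' [hi [hs hl2]]] := IHd _ _ _ (w ++ [:: Rp] ++ [:: Rn]) _ hin1.
- by rewrite addSnnS.
- by rewrite prog1 hw.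
exists s'; eexists; split=> //.
by apply: leads_weaken (lexx _) (leads_trans hl hl2); rewrite add0r.
Qed.

Lemma branch_prog_unbounded alpha c n :
  (forall m, reval c [:: n; seq_code (rev (mkseq alpha m))] 0) ->
  ~ bounded_runtime (branch_scheduler alpha)
      (init_estate (init_pstate (branch_prog c n))).
Proof.
move=> hc; set f := branch_scheduler alpha => -[B hB].
(* Each further entry adds at least 1, and the shifts in [leads] add up to the required cutoff. *)
have grow M m s : follows alpha c n m s -> exists N, M%:R <= runtime f N s.
  elim: M m s => [|M IHM] m s; first by exists 0%N; rewrite runtime0.
  case=> k [eta [w [-> hp hw]]].
  have a0 : 0 <= (2 ^ k)%:R^-1 :> rat by rewrite invr_ge0 ler0n.
  have [eta1 [hi1 [hin hl1]]] := main_loop_continue f w a0 hp (hc m).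
  have [|s' [hi2 [hs hl2]]] := choice_follows c (w := w ++ [:: Rp]) (add0n _) hin.
    by rewrite /word_progress foldl_cat -/(word_progress w) hw.
  have [N hN] := IHM _ _ hs.
  have [p [_ /(_ N)/andP[h _]]] := leads_trans hl1 hl2.
  by exists (p + N)%N; apply: le_trans h; rewrite -natr1; lra.
have [eta [hi [hp [p [_ hl]]]]] := init_leads f c n.
have [|N hN] := grow (Num.bound B) 0%N (EState (main_loop c) eta 1 [::]).
  by exists 0%N, eta, [::]; rewrite expn0 invr1.
have /andP[h _] := hl N; have := hB (p + N)%N.
rewrite leNgt => /negP[]; apply: lt_le_trans h; rewrite add0r.
apply: lt_le_trans hN; apply: le_lt_trans (ler_norm _) _.
by have := archi_boundP (normr_ge0 B); rewrite /Num.bound normr_id.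
Qed.

Lemma PAST_branch_prog c (test : nat -> seq nat -> bool) n :
  (forall L, reval c [:: n; seq_code (rev L)] (test n L)) ->
  PAST (branch_prog c n) <-> forall alpha, exists m, test n (mkseq alpha m).
Proof.
move=> hc; split=> [/PAST_runtime[_ h] alpha|h].
  apply: contrapT => /forallNP no.
  apply: (@branch_prog_unbounded alpha c n) => [m|].
    by have := hc (mkseq alpha m); have /negP/negbTE-> := no m.
  by have [B hB] := h (branch_scheduler alpha); exists B%:R.
apply/PAST_runtime; split=> // f; have [B hB] := branch_prog_bounded f hc h.
exists (Num.bound B) => N; apply: le_trans (hB N) _.
apply: ltW; apply: le_lt_trans (ler_norm _) _.
by have := archi_boundP (normr_ge0 B); rewrite /Num.bound normr_id.
Qed.

Lemma enc_rat_nat n : enc_rat n%:R = cpair n.*2 2.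
Proof. by rewrite /enc_rat -[n%:R]/(n%:Z%:~R) numq_int denq_int. Qed.

Lemma PAST_hard B : Pi11 B -> many_one_reducible B PAST_set.
Proof.
case=> test [[c hc] hB].
have [d hd] := comp_rev_code comp_id.
(* Precomposed with reversal, since the program passes the reversed prefix. *)
pose c' := RComp c [:: RProj 0; RComp d [:: RProj 1]].
have hc' n L : reval c' [:: n; seq_code (rev L)] (test n (seq_code L)).
  apply: (ev_comp (ms := [:: n; seq_code L])); last exact: hc.
  constructor; first exact: (ev_proj 0 [:: n; seq_code (rev L)]).
  constructor; last by constructor.
  apply: (ev_comp (ms := [:: seq_code (rev L)])).
    by constructor; [exact: (ev_proj 1 [:: n; seq_code (rev L)])|constructor].
  by have := hd [:: seq_code (rev L)]; rewrite /= rev_codeE revK.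
exists (fun n => enc_prog (branch_prog c' n)); split.
  (* Only the constant in the first assignment depends on [n], so the rest is a fixed number and the
     reduction is a few pairings. The pair of [n.*2] and 2 codes numerator [n] and denominator 1. *)
  set K := enc_prog (PSeq (PAssign v_time (AConst 1)) (main_loop c')).
  have h : computable (fun n =>
      cpair 2 (cpair (cpair 1 (cpair 0 (cpair 0 (cpair n.*2 2)))) K)).
    have hdbl := comp_double.
    by auto 20 with computability nocore.
  have enc n : enc_prog (branch_prog c' n) =
      cpair 2 (cpair (cpair 1 (cpair 0 (cpair 0 (cpair n.*2 2)))) K).
    by rewrite -enc_rat_nat.
  by case: h => e he; exists e => n; rewrite enc; exact: (he [:: n]).
move=> n; have := PAST_branch_prog (test := fun n L => test n (seq_code L)) (hc' n).
move=> e; split=> [/hB h|[P [/enc_prog_inj-> /e h]]].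
  by exists (branch_prog c' n); split=> //; apply/e => alpha; exact: h.
by apply/hB => alpha; exact: h.
Qed.

Theorem theorem4p2 : Pi11_complete PAST_set.
Proof. by split; [exact: PAST_Pi11|exact: PAST_hard]. Qed.
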